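(* Let $\omega_1,\omega_2\in\mathbb C$ be nonzero with $\omega_1/\omega_2\notin\mathbb R$, let $\Lambda=\{a\omega_1+b\omega_2: a,b\in\mathbb Z\}$, and let $\wp$ be the Weierstrass $\wp$-function of $\Lambda$ and $\wp'$ its derivative. Then, as meromorphic functions on $\mathbb C$, $$(\wp')^2=4\wp^3-60E_4\,\wp-140E_6 .$$
   Context: The Weierstrass $\wp$-function of $\Lambda$ is $\wp(z)=\frac{1}{z^2}+\sum_{\omega\in\Lambda\setminus\{0\}}\left(\frac{1}{(z+\omega)^2}-\frac{1}{\omega^2}\right)$. The Eisenstein series of $\Lambda$ are $E_k=\sum_{\omega\in\Lambda\setminus\{0\}}\frac{1}{\omega^k}$. *)

(* Defs.v *)
From HB Require Import structures.
From mathcomp Require Import all_boot all_order all_algebra.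
From mathcomp Require Import complex.
From mathcomp Require Import boolp classical_sets functions reals topology.
From mathcomp Require Import normedtype derive.
From mathcomp Require Import summability.

Set Implicit Arguments.
Unset Strict Implicit.
Unset Printing Implicit Defensive.

Import Order.TTheory GRing.Theory Num.Theory.
Import numFieldNormedType.Exports.

Local Open Scope classical_set_scope.
Local Open Scope ring_scope.

(* The complex numbers, presented as a [numFieldType] so that they carry the
   topology and the normed-module structure induced by the modulus; derivatives
   of functions [Cplx R -> Cplx R] are therefore complex derivatives. *)
Definition Cplx (R : realType) : numFieldType := R[i]%C.

Section Meromorphic.
Variable R : realType.
Implicit Types (f : Cplx R -> Cplx R) (S : set (Cplx R)) (z : Cplx R).

Definition holomorphic_at f z : Prop := \forall y \near z, derivable f y 1.

(* At most a pole at [z]; the value of [f] at [z] itself is irrelevant. *)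
Definition meromorphic_at f z : Prop :=
  exists (n : nat) (g : Cplx R -> Cplx R),
    holomorphic_at g z /\ \forall y \near z^', f y = (y - z) ^- n * g y.

Definition meromorphic_with_poles_in S f : Prop :=
  (forall z, ~ S z -> holomorphic_at f z) /\
  (forall z, S z -> meromorphic_at f z).

End Meromorphic.

Section Weierstrass.
Variables (R : realType) (w1 w2 : Cplx R).

Definition lattice : set (Cplx R) :=
  [set w | exists a b : int, w = a%:~R * w1 + b%:~R * w2].

(* The sum of [F] over the nonzero lattice points, as the limit of the finite
   partial sums along the directed family of all finite sets (unconditional
   summation); [F \_ A] extends the restriction of [F] to [A] by zero
   (the distinguished [point] of [Cplx R] is 0). *)
Definition lattice_sum (F : Cplx R -> Cplx R) : Cplx R :=
  summability.sum (F \_ (lattice `\ 0)).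

(* At a lattice point the value of [wp] is meaningless ([0^-1 = 0]). *)
Definition wp (z : Cplx R) : Cplx R :=
  z ^- 2 + lattice_sum (fun w => (z + w) ^- 2 - w ^- 2).

Definition dwp : Cplx R -> Cplx R := derive1 wp.

Definition eisenstein (k : nat) : Cplx R := lattice_sum (fun w => w ^- k).

End Weierstrass.

(* Main.v *)
(* Let f be the difference of the two sides of the equation, extended by 0 to the
   lattice. It is periodic, and the Laurent expansions of wp and wp' at 0 show that
   f(z) = O(z) there, so that f is continuous and, by compactness of a period
   parallelogram, bounded by some M. In place of Liouville's theorem, apply a weak
   maximum principle to g(z) = f(z)^2 / z, which is continuous, vanishes on the lattice
   and has second-order Taylor expansions elsewhere: for e > 0 the function
   |g(z)|^2 + e |z|^2 has no local maximum off the lattice, so on the parallelogram of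
   side 2N around 0 its maximum is attained on the lattice or on the boundary, where
   |g| <= M^2 / (c N). Letting e tend to 0 and then N to infinity gives g = 0.
   Only second-order Taylor expansions with explicit remainders are needed; they are
   summed over the lattice term by term. Periodicity of wp is a telescoping sum over
   boxes of lattice points. *)

Require Import Defs.
From mathcomp Require Import all_boot all_order all_algebra complex finmap.
From mathcomp Require Import boolp classical_sets functions reals topology.
From mathcomp Require Import normedtype derive summability.
From mathcomp Require Import zify ring lra.

Set Implicit Arguments.
Unset Strict Implicit.
Unset Printing Implicit Defensive.

Import Order.TTheory GRing.Theory Num.Theory.
Import numFieldNormedType.Exports.

Local Open Scope classical_set_scope.
Local Open Scope ring_scope.

(** At a lattice point f is only shown to be O(z), with no claim of holomorphy. The maximum
    principle therefore has to tolerate exceptional points, and it does because g vanishes there: a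
    maximum located at one of them has only the value e |z|^2. Dividing by z supplies the decay on
    the boundary that a merely bounded f lacks; squaring f first keeps the quotient continuous at 0,
    where f(z) / z would only be bounded. Everything quantitative rests on one majorant, (1 +
    |w|)^-3, whose sums over boxes are bounded: an estimate of each term by D times this majorant
    becomes an estimate of the sum by D K with K fixed. Expanding a lattice series is thus a matter
    of closed-form remainders of single terms, and derivatives, holomorphy and Laurent coefficients
    all come out of the same estimate. *)

(** * The real-valued modulus *)

(* The norm of the library on [Cplx R] is [Cplx R]-valued; estimates are made
   with its real-valued version, on which [lra] and [nra] work. *)
Definition cabs (R : realType) (z : Cplx R) : R := ComplexField.Normc.normc z.

Section Cabs.
Variable R : realType.
Local Notation C := (Cplx R).
Implicit Types x y z : C.

Lemma normE z : `|z| = (cabs z)%:C%C :> C.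
Proof. by []. Qed.

Lemma cabs_ge0 z : 0 <= cabs z.
Proof. by case: z => a b /=; exact: sqrtr_ge0. Qed.

Lemma cabs0 : cabs (0 : C) = 0.
Proof. exact: ComplexField.Normc.normc0. Qed.

Lemma cabs_eq0 z : (cabs z == 0) = (z == 0).
Proof.
apply/eqP/eqP => [|->]; first exact: ComplexField.Normc.eq0_normc.
exact: cabs0.
Qed.

Lemma cabs_gt0 z : (0 < cabs z) = (z != 0).
Proof. by rewrite lt_def cabs_eq0 cabs_ge0 andbT. Qed.

Lemma cabs1 : cabs (1 : C) = 1.
Proof. exact: ComplexField.Normc.normc1. Qed.

Lemma cabsM x y : cabs (x * y) = cabs x * cabs y.
Proof. exact: ComplexField.Normc.normcM. Qed.

Lemma cabsV x : cabs x^-1 = (cabs x)^-1.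
Proof. exact: ComplexField.Normc.normcV. Qed.

Lemma cabsX x n : cabs (x ^+ n) = cabs x ^+ n.
Proof.
elim: n => [|n IH]; first by rewrite !expr0 cabs1.
by rewrite !exprS cabsM IH.
Qed.

Lemma cabsN x : cabs (- x) = cabs x.
Proof. exact: normcN. Qed.

Lemma cabsD x y : cabs (x + y) <= cabs x + cabs y.
Proof. exact: le_normcD. Qed.

Lemma cabsB x y : cabs (x - y) <= cabs x + cabs y.
Proof. by rewrite -(cabsN y); exact: cabsD. Qed.

Lemma cabs_distrC x y : cabs (x - y) = cabs (y - x).
Proof. by rewrite -cabsN opprB. Qed.

Lemma lerB_cabsD x y : cabs x - cabs y <= cabs (x + y).
Proof. by have := cabsB (x + y) y; rewrite addrK; lra. Qed.

Lemma cabs_sum (I : Type) (s : seq I) (P : pred I) (F : I -> C) :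
  cabs (\sum_(i <- s | P i) F i) <= \sum_(i <- s | P i) cabs (F i).
Proof.
elim/big_ind2: _ => [|x1 x2 y1 y2 h1 h2|//]; first by rewrite cabs0.
by apply: le_trans (cabsD _ _) _; exact: lerD.
Qed.

Definition rc (t : R) : C := t%:C%C.

Lemma cabs_rc t : cabs (rc t) = `|t|.
Proof. by rewrite /cabs /= expr0n addr0 sqrtr_sqr. Qed.

Lemma cabs_rcM t z : cabs (rc t * z) = `|t| * cabs z.
Proof. by rewrite cabsM cabs_rc. Qed.

Lemma cabs_nat n : cabs (n%:R : C) = n%:R.
Proof.
have -> : n%:R = rc n%:R by rewrite /rc rmorph_nat.
by rewrite cabs_rc ger0_norm.
Qed.

Lemma sqr_cabs z : cabs z ^+ 2 = complex.Re z ^+ 2 + complex.Im z ^+ 2.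
Proof. by case: z => a b /=; rewrite sqr_sqrtr // addr_ge0 // sqr_ge0. Qed.

Lemma Re_le_cabs z : `|complex.Re z| <= cabs z.
Proof.
rewrite -(@ler_pXn2r _ 2) ?nnegrE ?cabs_ge0 // sqr_cabs.
by rewrite real_normK ?num_real // lerDl sqr_ge0.
Qed.

Lemma Im_le_cabs z : `|complex.Im z| <= cabs z.
Proof.
rewrite -(@ler_pXn2r _ 2) ?nnegrE ?cabs_ge0 // sqr_cabs.
by rewrite real_normK ?num_real // lerDr sqr_ge0.
Qed.

Lemma cabs_le_ReIm z : cabs z <= `|complex.Re z| + `|complex.Im z|.
Proof.
rewrite -(@ler_pXn2r _ 2) ?nnegrE ?cabs_ge0 ?addr_ge0 // sqr_cabs.
rewrite sqrrD !real_normK ?num_real // lerD2r lerDl.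
by rewrite mulrn_wge0 // mulr_ge0.
Qed.

Lemma near_cabsP z (P : set C) :
  (\forall y \near z, P y) <-> exists2 r : R, 0 < r & forall y, cabs (y - z) < r -> P y.
Proof.
split=> [/nbhs_ballP[e e0 H]|[r r0 H]].
  move: e0; rewrite /= ltcE /= => /andP[/eqP ie re].
  exists (complex.Re e) => // y hy; apply: H.
  rewrite /= /ball /= -opprB normrN normE ltcE /= ie eqxx /=; exact: hy.
apply/nbhs_ballP; exists (r%:C%C : C) => [|y]; first by rewrite /= ltcR.
by rewrite /ball /= -opprB normrN normE ltcR => /H.
Qed.

Lemma dnear_cabsP z (P : set C) :
  (\forall y \near z^', P y) <->
  exists2 r : R, 0 < r & forall y, y != z -> cabs (y - z) < r -> P y.
Proof.
split=> [/near_cabsP[r r0 H]|[r r0 H]].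
  by exists r => // y yz hy; exact: H.
by apply/near_cabsP; exists r => // y hy yz; exact: H.
Qed.

Lemma cvg_to_cabsP (T : Type) (F : set_system T) (FF : Filter F) (f : T -> C) (l : C) :
  (forall e : R, 0 < e -> \forall t \near F, cabs (f t - l) < e) -> f @ F --> l.
Proof.
move=> H; apply/cvgrPdist_lt => e; rewrite ltcE /= => /andP[/eqP ie re].
near=> t; rewrite -opprB normrN normE ltcE /= ie eqxx /=.
by near: t; exact: H.
Unshelve. all: by end_near. Qed.

End Cabs.

(** * Boxes of integers *)

Section Ranges.

(** Each step adds the two new endpoints as a pair, so that symmetry under negation and telescoping
    are one-step inductions. *)
Fixpoint int_box (N : nat) : seq int :=
  if N is N'.+1 then N'.+1%:Z :: - N'.+1%:Z :: int_box N' else [:: 0].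

Lemma mem_int_box N m : (m \in int_box N) = (`|m| <= N)%N.
Proof.
elim: N => [|N IH] /=; first by rewrite inE; lia.
by rewrite !inE IH; apply/idP/idP; lia.
Qed.

Lemma int_box_uniq N : uniq (int_box N).
Proof.
elim: N => [//|N IH] /=.
by rewrite !inE !mem_int_box IH; lia.
Qed.

Lemma size_int_box N : size (int_box N) = (2 * N + 1)%N.
Proof. by elim: N => [//|N IH] /=; lia. Qed.

Lemma sum_int_boxN (V : zmodType) (F : int -> V) N :
  \sum_(m <- int_box N) F (- m) = \sum_(m <- int_box N) F m.
Proof.
elim: N => [|N IH]; first by rewrite !big_seq1 oppr0.
by rewrite !big_cons IH opprK addrCA.
Qed.

Lemma telescope_int_box (V : zmodType) (F : int -> V) N :
  \sum_(m <- int_box N) (F (m + 1) - F m) = F (N%:Z + 1) - F (- N%:Z).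
Proof.
elim: N => [|N IH]; first by rewrite big_seq1 add0r oppr0.
rewrite !big_cons IH.
have -> : - N.+1%:Z + 1 = - N%:Z by lia.
have -> : N%:Z + 1 = N.+1%:Z by lia.
move: (F _) (F (- N%:Z)) (F N.+1%:Z) (F (- _)) => a b c d.
by rewrite addrCA (addrA (a - c)) subrK addrC addrA subrK.
Qed.

(** Comparison with a telescoping series: each of the two half-lines contributes at most [h 0]. *)
Lemma sum_int_box_le (R : numDomainType) (g h : nat -> R) N :
  (forall i, 0 <= h i) -> (forall i, 0 <= g i) -> (forall i, g i <= h i - h i.+1) ->
  \sum_(m <- int_box N) g `|m|%N <= 2 * h 0%N.
Proof.
move=> h0 g0 gh.
(* The strengthened bound keeps the telescoped remainder, which the induction needs. *)
suff: \sum_(m <- int_box N) g `|m|%N <= 2 * (h 0%N - h N.+1).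
  move=> /le_trans; apply; rewrite ler_pM2l //.
  by rewrite lerBlDr lerDl.
elim: N => [|N IH].
  by rewrite big_seq1 absz0 mulr_natl mulr2n; apply: le_trans (gh 0%N) _; rewrite lerDl (le_trans (g0 _) (gh _)).
rewrite !big_cons abszN.
have e : h 0%N - h N.+2 = (h 0%N - h N.+1) + (h N.+1 - h N.+2) by rewrite addrA subrK.
rewrite e mulrDr addrA [leRHS]addrC; apply: lerD => //.
by rewrite mulr_natl mulr2n; apply: lerD.
Qed.

(** The offset [a] stands for the other coordinate: summing the cube over one index leaves a square
    in the other, which [sum_int_box_inv2] sums. The factor 4 in the comparison function gives slack
    for the discrete step. *)
Lemma sum_int_box_inv3 (R : realType) (a : R) N : 0 <= a ->
  \sum_(n <- int_box N) (1 + a + `|n|%N%:R) ^- 3 <= 8 * (1 + a) ^- 2.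
Proof.
move=> a0.
have := @sum_int_box_le _ (fun i => (1 + a + i%:R) ^- 3)
  (fun i => 4 * (1 + a + i%:R) ^- 2) N.
rewrite addr0 => H; rewrite (_ : 8 = 2 * 4) -?mulrA; last by ring.
apply: H => i.
- by rewrite mulr_ge0 // invr_ge0 exprn_ge0 //; have := ler0n R i; lra.
- by rewrite invr_ge0 exprn_ge0 //; have := ler0n R i; lra.
- rewrite -[i.+1%:R]natr1 addrA; have := ler0n R i.
  move: (i%:R) => b b0; set x := 1 + a + b.
  have x1 : 1 <= x by rewrite /x; lra.
  have -> : 4 * x ^- 2 - 4 * (x + 1) ^- 2 = 4 * (2 * x + 1) / (x ^+ 2 * (x + 1) ^+ 2).
    by field; apply/andP; split; lra.
  rewrite ler_pdivlMr; last by rewrite mulr_gt0 // exprn_gt0 //; lra.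
  rewrite [X in X <= _](_ : _ = (x + 1) ^+ 2 / x); last by field; lra.
  by rewrite ler_pdivrMr; [nra | lra].
Qed.

Lemma sum_int_box_inv2 (R : realType) N :
  \sum_(n <- int_box N) (1 + `|n|%N%:R : R) ^- 2 <= 4.
Proof.
have := @sum_int_box_le _ (fun i => (1 + i%:R : R) ^- 2)
  (fun i => 2 * (1 + i%:R : R) ^- 1) N.
rewrite addr0 invr1 mulr1 => H; rewrite (_ : 4 = 2 * 2) -?mulrA; last by ring.
apply: H => i.
- by rewrite mulr_ge0 // invr_ge0; have := ler0n R i; lra.
- by rewrite invr_ge0 exprn_ge0 //; have := ler0n R i; lra.
- rewrite -[i.+1%:R]natr1 addrA; have := ler0n R i.
  move: (i%:R) => b b0; set x := 1 + b.
  have x1 : 1 <= x by rewrite /x; lra.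
  have -> : 2 * x^-1 - 2 * (x + 1)^-1 = 2 / (x * (x + 1)).
    by field; apply/andP; split; lra.
  rewrite ler_pdivlMr; last by rewrite mulr_gt0 //; lra.
  rewrite [X in X <= _](_ : _ = (x + 1) / x); last by field; lra.
  by rewrite ler_pdivrMr; lra.
Qed.

End Ranges.

(** * Finite sums over nested sequences *)

Section SeqSums.
Variables (T : eqType) (R : realType).

Lemma perm_filter_mem (s t : seq T) : uniq s -> uniq t -> {subset s <= t} ->
  perm_eq [seq x <- t | x \in s] s.
Proof.
move=> us ut st; apply: uniq_perm => //; first exact: filter_uniq.
move=> x; rewrite mem_filter; apply/andP/idP => [[]//|xs]; split => //; exact: st.
Qed.

Lemma sum_split_mem (V : nmodType) (s t : seq T) (F : T -> V) :
  uniq s -> uniq t -> {subset s <= t} ->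
  \sum_(x <- t) F x = \sum_(x <- s) F x + \sum_(x <- t | x \notin s) F x.
Proof.
move=> us ut st; rewrite (bigID (mem s)) /=; congr (_ + _).
by rewrite -big_filter; apply: perm_big; exact: perm_filter_mem.
Qed.

Lemma ler_sum_sub (s t : seq T) (F : T -> R) :
  uniq s -> uniq t -> {subset s <= t} -> (forall x, 0 <= F x) ->
  \sum_(x <- s) F x <= \sum_(x <- t) F x.
Proof.
move=> us ut st F0; rewrite (sum_split_mem _ us ut st) lerDl.
by apply: sumr_ge0.
Qed.

End SeqSums.

Lemma monotone_bounded_cvg (R : realType) (u : nat -> R) (K : R) :
  (forall n, u n <= u n.+1) -> (forall n, u n <= K) ->
  exists l, forall e, 0 < e -> exists N, forall n, (N <= n)%N -> `|u n - l| < e.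
Proof.
move=> um uK; pose E : set R := range u.
have hs : has_sup E.
  split; first by exists (u 0%N), 0%N.
  by exists K => _ [n _ <-].
have um' : {homo u : m n / (m <= n)%N >-> m <= n}.
  by apply: homo_leq => // x y z; exact: le_trans.
exists (sup E) => e e0; have [_ [N _ <-] h] := sup_adherent e0 hs.
exists N => n Nn; have := um' _ _ Nn => h2.
have h3 : u n <= sup E by apply: ub_le_sup; [exact: hs.2|exists n].
by rewrite ler0_norm; lra.
Qed.

(** * Summation over a lattice *)

Section RealBasis.
Variables (R : realType) (w1 w2 : Cplx R).
Hypothesis (w2_neq0 : w2 != 0) (w12 : w1 / w2 \isn't Num.real).
Local Notation C := (Cplx R).

Lemma Im_basis_neq0 : complex.Im (w1 / w2) != 0.
Proof. by move: w12; case: (w1 / w2) => a b; rewrite complex_real. Qed.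

(** Dividing by [w2] reduces to [s * (w1 / w2) + t]: its imaginary part controls [s], and then the
    triangle inequality controls [t]. *)
Lemma basis_bound : exists2 c : R, 0 < c <= 1 &
  forall s t : R, c * (`|s| + `|t|) <= cabs (rc s * w1 + rc t * w2).
Proof.
have b0 := Im_basis_neq0; set a := complex.Re (w1 / w2); set b := complex.Im (w1 / w2) in b0.
have w20 : 0 < cabs w2 by rewrite cabs_gt0.
pose tau := cabs (w1 / w2).
have tau0 : 0 <= tau by apply: cabs_ge0.
have bp : 0 < `|b| by rewrite normr_gt0.
pose K := `|b|^-1 + 1 + tau / `|b|.
have K0 : 0 < K by rewrite /K ltr_wpDr ?addr_gt0 ?invr_gt0 // divr_ge0.
have step s t : `|s| + `|t| <= K * cabs (rc s * (w1 / w2) + rc t).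
  set X := cabs _.
  have h1 : `|s| * `|b| <= X.
    rewrite -normrM; apply: le_trans (Im_le_cabs _).
    rewrite le_eqVlt; apply/orP; left; apply/eqP; congr `|_|.
    by rewrite /b; case: (w1 / w2) => p q /=; ring.
  have h1' : `|s| <= X / `|b| by rewrite ler_pdivlMr.
  have h2 : `|t| <= X + `|s| * tau.
    have := cabsB (rc s * (w1 / w2) + rc t) (rc s * (w1 / w2)).
    by rewrite addrC addKr cabs_rcM cabs_rc.
  have h3 : `|s| * tau <= X / `|b| * tau by rewrite ler_wpM2r.
  apply: (@le_trans _ _ (X / `|b| + (X + X / `|b| * tau))); first by lra.
  suff -> : K * X = X / `|b| + (X + X / `|b| * tau) by [].
  by rewrite /K; field; rewrite gt_eqF.
have wE s t : rc s * w1 + rc t * w2 = (rc s * (w1 / w2) + rc t) * w2.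
  by rewrite mulrDl mulrA mulfVK.
(* The cap at 1 later allows [c * (1 + |m| + |n|)] to be bounded by [1 + |w|]. *)
pose c := Num.min 1 (cabs w2 / K).
have c0 : 0 < c by rewrite /c lt_min ltr01 divr_gt0.
exists c; first by rewrite c0 /c ge_min lexx.
move=> s t; rewrite wE cabsM.
apply: (@le_trans _ _ (cabs w2 / K * (`|s| + `|t|))).
  by rewrite ler_wpM2r ?addr_ge0 // /c ge_min lexx orbT.
by rewrite -mulrA [leRHS]mulrC ler_pM2l // ler_pdivrMl.
Qed.

Lemma basis_coord (z : C) : exists s t : R, z = rc s * w1 + rc t * w2.
Proof.
have b0 := Im_basis_neq0.
have [s [t e]] : exists s t : R, z / w2 = rc s * (w1 / w2) + rc t.
  move: b0; case: (w1 / w2) (z / w2) => [a b] [x y] /= b0.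
  exists (y / b), (x - y / b * a); apply/eqP; rewrite eq_complex /=.
  by apply/andP; split; apply/eqP; field.
exists s, t; have -> : z = z / w2 * w2 by rewrite mulfVK.
by rewrite e mulrDl mulrA mulfVK.
Qed.

End RealBasis.

Section LatticeSums.
Variables (R : realType) (w1 w2 : Cplx R).
Hypothesis (w2_neq0 : w2 != 0) (w12 : w1 / w2 \isn't Num.real).
Local Notation C := (Cplx R).
Local Notation L := (lattice w1 w2).

Definition lattice_pt (m n : int) : C := m%:~R * w1 + n%:~R * w2.

Lemma lattice_pt_in m n : L (lattice_pt m n).
Proof. by exists m, n. Qed.

Lemma latticeN w : L w -> L (- w).
Proof. by move=> [m [n ->]]; exists (- m), (- n); rewrite !mulrNz !mulNr opprD. Qed.

Lemma latticeD v w : L v -> L w -> L (v + w).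
Proof.
by move=> [m [n ->]] [p [q ->]]; exists (m + p), (n + q); rewrite !mulrzDr; ring.
Qed.

Lemma lattice0 : L 0.
Proof. by exists 0, 0; rewrite !mul0r addr0. Qed.

Lemma rc_int (m : int) : rc m%:~R = m%:~R :> C.
Proof. by rewrite /rc rmorph_int. Qed.

Lemma lattice_pt_bound : exists2 c : R, 0 < c <= 1 &
  forall m n, c * (`|m|%N%:R + `|n|%N%:R) <= cabs (lattice_pt m n).
Proof.
have [c c0 H] := basis_bound w2_neq0 w12; exists c => // m n.
by have := H m%:~R n%:~R; rewrite !rc_int -!intr_norm.
Qed.

Lemma lattice_pt_inj m n p q : lattice_pt m n = lattice_pt p q -> m = p /\ n = q.
Proof.
move=> e; have [c /andP[c0 _] H] := lattice_pt_bound.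
have := H (m - p) (n - q).
have -> : lattice_pt (m - p) (n - q) = lattice_pt m n - lattice_pt p q by rewrite /lattice_pt !mulrzBr; ring.
rewrite e subrr cabs0 pmulr_rle0 // -natrD (_ : 0 = 0%N%:R) // ler_nat => h.
by split; lia.
Qed.

Definition box (N : nat) : seq C := [seq lattice_pt m n | m <- int_box N, n <- int_box N].

Lemma mem_box N m n : (lattice_pt m n \in box N) = (`|m| <= N)%N && (`|n| <= N)%N.
Proof.
rewrite -!mem_int_box; apply/allpairsP/andP => [[[p q] /= [hp hq /lattice_pt_inj[-> ->]]]|[]] //.
by move=> hm hn; exists (m, n).
Qed.

Lemma box_lattice N w : w \in box N -> L w.
Proof. by move=> /allpairsP[[p q] /= [_ _ ->]]; exact: lattice_pt_in. Qed.

Lemma box_uniq N : uniq (box N).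
Proof.
apply: allpairs_uniq; [exact: int_box_uniq|exact: int_box_uniq|].
by move=> [m n] [p q] _ _ /lattice_pt_inj[-> ->].
Qed.

Lemma box_mono N M : (N <= M)%N -> {subset box N <= box M}.
Proof.
move=> NM w wN; have [m [n e]] := box_lattice wN; move: wN.
rewrite [w]e -/(lattice_pt m n) !mem_box => /andP[h1 h2].
by rewrite (leq_trans h1) // (leq_trans h2).
Qed.

Lemma box_exhaust w : L w -> exists N, w \in box N.
Proof.
move=> [m [n ->]]; exists (maxn `|m| `|n|).
by rewrite -/(lattice_pt m n) mem_box; lia.
Qed.

Lemma box_exhaust_seq (s : seq C) :
  exists N, forall w, w \in s -> L w -> w \in box N.
Proof.
elim: s => [|v s [N IH]]; first by exists 0%N.
have [M hM] : exists M, L v -> v \in box M.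
  have [/box_exhaust[M hM]|nv] := pselect (L v); first by exists M.
  by exists 0%N.
exists (maxn M N) => w; rewrite inE => /orP[/eqP -> /hM|/IH h /h].
  by apply: box_mono; lia.
by apply: box_mono; lia.
Qed.

Definition box_sum N (F : C -> C) : C := \sum_(w <- box N) F w.

Lemma box_sumE (V : nmodType) N (F : C -> V) :
  \sum_(w <- box N) F w = \sum_(m <- int_box N) \sum_(n <- int_box N) F (lattice_pt m n).
Proof. by rewrite big_allpairs_dep. Qed.

(** The common majorant of all summands: cubic decay is summable over a lattice of rank two, and the
    shift by 1 keeps it positive at the origin. *)
Definition weight (w : C) : R := (1 + cabs w) ^- 3.

Lemma weight_gt0 w : 0 < weight w.
Proof. by rewrite invr_gt0 exprn_gt0 // ltr_wpDr // cabs_ge0. Qed.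

Lemma weight_sum_bound : exists2 K, 0 < K & forall N, \sum_(w <- box N) weight w <= K.
Proof.
have [c /andP[c0 c1] H] := lattice_pt_bound.
(* [c ^- 3] passes from [1 + |w|] to [1 + |m| + |n|]; 32 is 8 from the inner sum times 4 from the
   outer one. *)
exists (c ^- 3 * 32) => [|N]; first by rewrite mulr_gt0 ?invr_gt0 ?exprn_gt0.
rewrite box_sumE.
apply: (@le_trans _ _ (\sum_(m <- int_box N) c ^- 3 * (8 * (1 + `|m|%N%:R) ^- 2))).
  apply: ler_sum => m _.
  apply: (@le_trans _ _ (\sum_(n <- int_box N) c ^- 3 * (1 + `|m|%N%:R + `|n|%N%:R) ^- 3)).
    apply: ler_sum => n _; rewrite /weight -invfM -exprMn.
    have mn : 0 <= `|m|%N%:R + `|n|%N%:R :> R by rewrite addr_ge0.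
    rewrite lef_pV2 ?posrE ?exprn_gt0 ?ltr_wpDr ?cabs_ge0 ?mulr_gt0 //; try by lra.
    rewrite ler_pXn2r ?nnegrE ?addr_ge0 ?cabs_ge0 ?mulr_ge0 ?addr_ge0 //; last by lra.
    by have := H m n; lra.
  by rewrite -mulr_sumr ler_pM2l ?invr_gt0 ?exprn_gt0 // sum_int_box_inv3.
rewrite -!mulr_sumr ler_pM2l ?invr_gt0 ?exprn_gt0 //.
by have := @sum_int_box_inv2 R N; lra.
Qed.

Definition dominated (F : C -> C) (D : R) :=
  forall w, L w -> cabs (F w) <= D * weight w.

(** Summation along boxes, origin included: this order of summation gives access to telescoping and
    to the symmetry under negation. *)
Definition box_cvg (F : C -> C) (l : C) :=
  forall e : R, 0 < e -> exists N0, forall N, (N0 <= N)%N -> cabs (box_sum N F - l) < e.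

Lemma weight_tail (e : R) : 0 < e -> exists N, forall M, (N <= M)%N ->
  \sum_(w <- box M | w \notin box N) weight w < e.
Proof.
move=> e0; have [K _ HK] := weight_sum_bound.
have [|l H] := @monotone_bounded_cvg R (fun N => \sum_(w <- box N) weight w) K _ HK.
  move=> N; apply: ler_sum_sub => [||w|w]; rewrite ?box_uniq //.
    exact: box_mono.
  exact/ltW/weight_gt0.
have [N HN] := H (e / 2) ltac:(lra); exists N => M NM.
have := HN M NM; have := HN N (leqnn _).
rewrite (sum_split_mem _ (box_uniq N) (box_uniq M) (box_mono NM)).
by rewrite !ltr_norml => /andP[? ?] /andP[? ?]; lra.
Qed.

(** [f + D * weight] lies between 0 and [2 D * weight], so its box sums are monotone and bounded;
    the limit of the weights is then subtracted. *)
Lemma real_box_cvg (f : C -> R) (D : R) :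
  (forall w, L w -> `|f w| <= D * weight w) ->
  exists l, forall e, 0 < e -> exists N0, forall N, (N0 <= N)%N ->
     `|\sum_(w <- box N) f w - l| < e.
Proof.
move=> fD; have [K K0 HK] := weight_sum_bound.
have D0 : 0 <= D.
  have := fD _ lattice0; have := weight_gt0 0 => h0 h1.
  by rewrite -(pmulr_lge0 _ h0); apply: le_trans h1.
have mono N (g : C -> R) : (forall w, L w -> 0 <= g w) ->
    \sum_(w <- box N) g w <= \sum_(w <- box N.+1) g w.
  move=> g0; rewrite (sum_split_mem _ (box_uniq N) (box_uniq N.+1) (box_mono (leqnSn _))).
  by rewrite lerDl big_seq_cond; apply: sumr_ge0 => w /andP[/box_lattice h _]; exact: g0.
have [|N|l1 H1] := @monotone_bounded_cvg R
   (fun N => \sum_(w <- box N) (f w + D * weight w)) (2 * D * K) _ _.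
- move=> N; apply: mono => w /fD; rewrite ler_norml => /andP[? ?]; lra.
- apply: (@le_trans _ _ (\sum_(w <- box N) 2 * D * weight w)).
    rewrite big_seq [leRHS]big_seq; apply: ler_sum => w /box_lattice /fD.
    rewrite ler_norml => /andP[? ?]; lra.
  by rewrite -mulr_sumr ler_wpM2l // mulr_ge0.
have [|l2 H2] := @monotone_bounded_cvg R (fun N => \sum_(w <- box N) weight w) K _ HK.
  by move=> N; apply: mono => w _; exact/ltW/weight_gt0.
exists (l1 - D * l2) => e e0.
have [N1 HN1] := H1 (e / 2) ltac:(lra).
(* [D + 1] rather than [D], since [D] may be 0. *)
have e2 : 0 < e / 2 / (D + 1) by rewrite !divr_gt0 //; lra.
have [N2 HN2] := H2 _ e2.
exists (maxn N1 N2) => N; rewrite geq_max => /andP[/HN1 h1 /HN2 h2].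
move: h1 h2; rewrite big_split /= -mulr_sumr.
set x := \sum_(i <- _) f i; set y := \sum_(i <- _) weight i => h1 h2.
have h3 : D * `|y - l2| <= e / 2.
  apply: (@le_trans _ _ ((D + 1) * `|y - l2|)); first by rewrite ler_wpM2r //; lra.
  by rewrite -ler_pdivlMl ?(mulrC (D + 1)^-1) ?ltW //; lra.
have -> : x - (l1 - D * l2) = (x + D * y - l1) - D * (y - l2) by ring.
apply: le_lt_trans (ler_normB _ _) _; rewrite normrM (ger0_norm D0); lra.
Qed.

Lemma dominated_box_cvg F D : dominated F D -> exists l, box_cvg F l.
Proof.
move=> FD.
have [|a Ha] := @real_box_cvg (fun w => complex.Re (F w)) D.
  by move=> w /FD; apply: le_trans; exact: Re_le_cabs.
have [|b Hb] := @real_box_cvg (fun w => complex.Im (F w)) D.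
  by move=> w /FD; apply: le_trans; exact: Im_le_cabs.
exists (Complex a b) => e e0.
have [N1 H1] := Ha (e / 2) ltac:(lra); have [N2 H2] := Hb (e / 2) ltac:(lra).
exists (maxn N1 N2) => N; rewrite geq_max => /andP[/H1 h1 /H2 h2].
apply: le_lt_trans (cabs_le_ReIm _) _.
have ReS : complex.Re (box_sum N F) = \sum_(w <- box N) complex.Re (F w).
  by rewrite /box_sum; apply: (big_morph (@complex.Re R)) => // -[? ?] [? ?].
have ImS : complex.Im (box_sum N F) = \sum_(w <- box N) complex.Im (F w).
  by rewrite /box_sum; apply: (big_morph (@complex.Im R)) => // -[? ?] [? ?].
rewrite -ReS in h1; rewrite -ImS in h2.
move: h1 h2; case: (box_sum N F) => p q /= h1 h2; lra.
Qed.

(** Unconditional and box summation agree: a finite set containing a large box differs from it by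
    points whose total weight is a small tail. [F 0] is subtracted because boxes contain the origin,
    which [lattice_sum] leaves out. *)
Lemma box_cvg_lattice_sum F D l : dominated F D -> box_cvg F l -> lattice_sum w1 w2 F = l - F 0.
Proof.
move=> FD Fl; have ? := @totally_filter C.
apply: cvg_lim; first exact: norm_hausdorff.
have D0 : 0 <= D.
  have := FD _ lattice0; have := weight_gt0 0 => h0 h1.
  by rewrite -(pmulr_lge0 _ h0); apply: le_trans h1; exact: cabs_ge0.
set G := F \_ _.
have GE w : G w = if (w \in L) && (w != 0) then F w else 0.
  rewrite /G /patch in_setD; congr (if _ then _ else _).
  congr (_ && ~~ _); apply/idP/eqP => [/set_mem//|->]; exact/mem_set.
apply: cvg_to_cabsP => e e0.
have [N1 H1] := Fl (e / 2) ltac:(lra).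
have e2 : 0 < e / 2 / (D + 1) by rewrite !divr_gt0 //; lra.
have [N2 H2] := weight_tail e2.
pose N := maxn N1 N2.
exists [fset w | w in box N]%fset => // A /= /fsubsetP sA.
have {}sA : {subset box N <= enum_fset A} by move=> w hw; apply: sA; rewrite inE.
rewrite /partial_sum -(big_seq_fsetE _ _ predT G) /=.
rewrite (sum_split_mem _ (box_uniq N) (fset_uniq A) sA).
have zN : (0 : C) \in box N.
  have -> : 0 = lattice_pt 0 0 by rewrite /lattice_pt !mul0r addr0.
  by rewrite mem_box.
have -> : \sum_(w <- box N) G w = box_sum N F - F 0.
  rewrite /box_sum !(bigD1_seq 0 zN (box_uniq N)) /= GE eqxx andbF add0r (addrC (F 0)) addrK.
  rewrite big_seq_cond [RHS]big_seq_cond; apply: eq_bigr => w /andP[wN w0].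
  by rewrite GE w0 (mem_set (box_lattice wN)).
(* The lattice points of [A] lie in some larger box, whose part outside [box N] bounds the rest of
   the sum. *)
have [M0 HM0] := box_exhaust_seq (enum_fset A).
pose M := maxn N M0.
have NM : (N <= M)%N by rewrite leq_maxl.
have tail : cabs (\sum_(w <- enum_fset A | w \notin box N) G w) <=
    D * \sum_(w <- box M | w \notin box N) weight w.
  apply: le_trans (cabs_sum _ _ _) _.
  rewrite mulr_sumr.
  apply: (@le_trans _ _ (\sum_(w <- enum_fset A | (w \notin box N) && (w \in L)) D * weight w)).
    rewrite [leRHS]big_mkcondr; apply: ler_sum => w wN; rewrite GE.
    case: ifPn => [/andP[/[dup] /set_mem wL -> _]|]; first exact: FD.
    by rewrite cabs0; case: ifP => // _ _; rewrite mulr_ge0 // ltW // weight_gt0.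
  rewrite -big_filter -[leRHS]big_filter; apply: ler_sum_sub.
  - by rewrite filter_uniq // fset_uniq.
  - by rewrite filter_uniq // box_uniq.
  - move=> w; rewrite !mem_filter => /andP[/andP[-> /set_mem wL] wA] /=.
    by apply: (@box_mono M0); [rewrite leq_maxr|exact: HM0].
  - by move=> w; rewrite mulr_ge0 // ltW // weight_gt0.
have tail2 : \sum_(w <- box M | w \notin box N) weight w < e / 2 / (D + 1).
  apply: le_lt_trans (H2 M _); last by rewrite (leq_trans _ NM) // leq_maxr.
  rewrite -big_filter -[leRHS]big_filter; apply: ler_sum_sub.
  - by rewrite filter_uniq // box_uniq.
  - by rewrite filter_uniq // box_uniq.
  - move=> w; rewrite !mem_filter => /andP[wN ->]; rewrite andbT.
    by apply: contra wN; apply: box_mono; rewrite leq_maxr.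
  - by move=> w; rewrite ltW // weight_gt0.
have h1 := H1 N (leq_maxl _ _).
set S := \sum_(w <- enum_fset A | _) _ in tail *.
have -> : box_sum N F - F 0 + S - (l - F 0) = (box_sum N F - l) + S by ring.
apply: le_lt_trans (cabsD _ _) _.
set T := \sum_(w <- box M | _) _ in tail tail2.
have h3 : D * T <= e / 2.
  have T0 : 0 <= T by apply: sumr_ge0 => w _; rewrite ltW // weight_gt0.
  apply: (@le_trans _ _ ((D + 1) * T)); first by rewrite ler_wpM2r //; lra.
  by rewrite -ler_pdivlMl ?(mulrC (D + 1)^-1) ?ltW //; lra.
lra.
Qed.

End LatticeSums.

(** * Limits along boxes: algebra, symmetry, uniform bounds, telescoping *)

Section LatticeSumTheory.
Variables (R : realType) (w1 w2 : Cplx R).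
Hypothesis (w2_neq0 : w2 != 0) (w12 : w1 / w2 \isn't Num.real).
Local Notation C := (Cplx R).
Local Notation L := (lattice w1 w2).
Local Notation box_cvg := (box_cvg w1 w2).
Local Notation box_sum := (box_sum w1 w2).
Local Notation box := (box w1 w2).
Local Notation dominated := (dominated w1 w2).
Implicit Types (F G : C -> C) (l : C).

Lemma box_cvg_unique F l l' : box_cvg F l -> box_cvg F l' -> l = l'.
Proof.
move=> h h'; apply/eqP; rewrite -subr_eq0 -cabs_eq0; apply/eqP.
apply: le_anti; rewrite cabs_ge0 andbT.
apply/ler_addgt0Pl => e e0; rewrite addr0.
have [N1 H1] := h (e / 2) ltac:(lra); have [N2 H2] := h' (e / 2) ltac:(lra).
have := H1 _ (leq_maxl N1 N2); have := H2 _ (leq_maxr N1 N2).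
set x := box_sum _ _; rewrite cabs_distrC => a b.
have := cabsD (l' - x) (x - l); rewrite addrA subrK (cabs_distrC l') (cabs_distrC l').
by move: a; rewrite (cabs_distrC l'); lra.
Qed.

Lemma box_cvg_ext F G l : (forall w, L w -> F w = G w) -> box_cvg F l -> box_cvg G l.
Proof.
move=> FG h e /h[N H]; exists N => M /H; rewrite /box_sum.
by under eq_big_seq => w /box_lattice /FG -> do [].
Qed.

Lemma box_cvgD F G l l' : box_cvg F l -> box_cvg G l' -> box_cvg (fun w => F w + G w) (l + l').
Proof.
move=> h h' e e0.
have [N1 H1] := h (e / 2) ltac:(lra); have [N2 H2] := h' (e / 2) ltac:(lra).
exists (maxn N1 N2) => N; rewrite geq_max => /andP[/H1 a /H2 b].
rewrite /box_sum big_split /= opprD addrACA.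
by apply: le_lt_trans (cabsD _ _) _; move: a b; rewrite /box_sum; lra.
Qed.

Lemma box_cvgZ F l (c : C) : box_cvg F l -> box_cvg (fun w => c * F w) (c * l).
Proof.
move=> h e e0; have c0 := cabs_ge0 c.
have e2 : 0 < e / (cabs c + 1) by rewrite divr_gt0 //; lra.
have [N H] := h _ e2; exists N => M /H.
rewrite /box_sum -mulr_sumr -mulrBr cabsM ltr_pdivlMr; last lra.
have := cabs_ge0 (box_sum M F - l); rewrite /box_sum; nra.
Qed.

Lemma box_cvgB F G l l' : box_cvg F l -> box_cvg G l' -> box_cvg (fun w => F w - G w) (l - l').
Proof.
move=> h h'; rewrite -(mulN1r l').
by apply: (box_cvg_ext _ (box_cvgD h (box_cvgZ (-1) h'))) => w _; rewrite mulN1r.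
Qed.

(** Boxes are symmetric, so each box sum equals its own opposite and vanishes before any limit is
    taken. *)
Lemma box_cvg_odd F l : (forall w, F (- w) = - F w) -> box_cvg F l -> l = 0.
Proof.
move=> odd h; apply/eqP; rewrite -cabs_eq0; apply/eqP; apply: le_anti.
rewrite cabs_ge0 andbT; apply/ler_addgt0Pl => e e0; rewrite addr0.
have [N H] := h e e0; have := H N (leqnn _).
suff -> : box_sum N F = 0 by rewrite sub0r cabsN => /ltW.
have e1 : box_sum N (fun w => F (- w)) = box_sum N F.
  rewrite /box_sum !box_sumE -sum_int_boxN; apply: eq_bigr => m _.
  rewrite -sum_int_boxN; apply: eq_bigr => n _; congr F.
  by rewrite /lattice_pt !mulrNz !mulNr opprD !opprK.
have e2 : box_sum N (fun w => F (- w)) = - box_sum N F.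
  by rewrite /box_sum -sumrN; apply: eq_bigr.
by move/eqP: e2; rewrite e1 -addr_eq0 -mulr2n mulrn_eq0 /= => /eqP.
Qed.

(** [K] is the same for all [F]. Applied to the Taylor remainders of the terms, this is what permits
    expansion term by term. *)
Lemma box_cvg_bound : exists2 K : R, 0 < K &
  forall F D l, dominated F D -> box_cvg F l -> cabs l <= D * K.
Proof.
have [K K0 HK] := weight_sum_bound w2_neq0 w12; exists K => // F D l FD h.
have D0 : 0 <= D.
  have := FD _ (@lattice0 _ w1 w2); have := weight_gt0 (0 : C) => h0 h1.
  by rewrite -(pmulr_lge0 _ h0); apply: le_trans h1; exact: cabs_ge0.
apply/ler_addgt0Pl => e e0; have [N H] := h e e0.
have hl := H N (leqnn _).
have hb : cabs (box_sum N F) <= D * K.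
  apply: le_trans (cabs_sum _ _ _) _.
  apply: (@le_trans _ _ (D * \sum_(w <- box N) weight w)); last by rewrite ler_wpM2l.
  rewrite mulr_sumr big_seq [leRHS]big_seq; apply: ler_sum => w /box_lattice; exact: FD.
by have := cabsB (box_sum N F) (box_sum N F - l); rewrite opprB addrC subrK; lra.
Qed.

(* Over a box the differences telescope, leaving two sides of the box, that is
   O(N) terms of size O(1/N^2). *)
Lemma box_cvg_telescope F (D : R) :
  (forall w, L w -> cabs (F w) <= D * (1 + cabs w) ^- 2) ->
  box_cvg (fun w => F (w + w1) - F w) 0 /\ box_cvg (fun w => F (w + w2) - F w) 0.
Proof.
move=> FD; have [c /andP[c0 c1] H] := lattice_pt_bound w2_neq0 w12.
have D0 : 0 <= D.
  have := FD _ (@lattice0 _ w1 w2); rewrite cabs0 addr0 expr1n invr1 mulr1.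
  exact/le_trans/cabs_ge0.
(* A lattice point with a coordinate of size at least [N] satisfies [1 + |w| >= c (N + 1)], by
   [c <= 1]. *)
have side (m n : int) N : (N <= `|m| + `|n|)%N ->
    cabs (F (lattice_pt w1 w2 m n)) <= D / (c * N.+1%:R) ^+ 2.
  move=> hN; apply: le_trans (FD _ (lattice_pt_in _ _ _ _)) _.
  rewrite ler_wpM2l // lef_pV2 ?posrE ?exprn_gt0 ?mulr_gt0 ?ltr_wpDr ?cabs_ge0 //.
  rewrite ler_pXn2r ?nnegrE ?addr_ge0 ?cabs_ge0 ?mulr_ge0 ?(ltW c0) //.
  have := H m n; rewrite -natrD => h.
  have : c * N%:R <= c * (`|m| + `|n|)%N%:R by rewrite ler_pM2l // ler_nat.
  by rewrite -natr1; lra.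
have main N (G : int -> C) : (forall n, cabs (G n) <= D / (c * N.+1%:R) ^+ 2 + D / (c * N.+1%:R) ^+ 2) ->
    cabs (\sum_(n <- int_box N) G n) <= 4 * D / c ^+ 2 / N.+1%:R.
  move=> hG; apply: le_trans (cabs_sum _ _ _) _.
  apply: le_trans (ler_sum _ (fun n _ => hG n)) _.
  rewrite big_const_seq count_predT size_int_box iter_addr_0.
  set x : R := N.+1%:R; have x0 : 0 < x by rewrite /x.
  rewrite -[X in X <= _]mulr_natr.
  (* The [2 N + 1] entries are rounded up to [2 (N + 1)], so that one factor [N + 1] cancels. *)
  apply: (@le_trans _ _ ((D / (c * x) ^+ 2 + D / (c * x) ^+ 2) * (2 * x))).
    rewrite ler_wpM2l //; first by rewrite addr_ge0 // divr_ge0 // exprn_ge0 // mulr_ge0 // ltW.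
    by rewrite /x -natrM ler_nat; lia.
  suff -> : (D / (c * x) ^+ 2 + D / (c * x) ^+ 2) * (2 * x) = 4 * D / c ^+ 2 / x by [].
  by clearbody x; field; rewrite (gt_eqF c0) (gt_eqF x0).
have tend (u : nat -> C) : (forall N, cabs (u N) <= 4 * D / c ^+ 2 / N.+1%:R) ->
    forall e, 0 < e -> exists N0, forall N, (N0 <= N)%N -> cabs (u N - 0) < e.
  move=> hu e e0; set A := 4 * D / c ^+ 2 in hu.
  exists (Num.bound (A / e)) => N hN; rewrite subr0; apply: le_lt_trans (hu N) _.
  have A0 : 0 <= A / e by rewrite !divr_ge0 ?mulr_ge0 ?exprn_ge0 // ltW.
  have := archi_boundP A0; rewrite ltr_pdivrMr // => h.
  rewrite ltr_pdivrMr // mulrC; apply: lt_le_trans h _.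
  by rewrite ler_pM2r // ler_nat ltnW.
have l1 m n : lattice_pt w1 w2 m n + w1 = lattice_pt w1 w2 (m + 1) n by rewrite /lattice_pt mulrzDr; ring.
have l2 m n : lattice_pt w1 w2 m n + w2 = lattice_pt w1 w2 m (n + 1) by rewrite /lattice_pt mulrzDr; ring.
split; apply: tend => N; rewrite /box_sum box_sumE.
  (* For the shift by [w1] the first index has to be the inner one. *)
  rewrite exchange_big /=; apply: main.
  suff key n : cabs (\sum_(i <- int_box N) (F (lattice_pt w1 w2 i n + w1) - F (lattice_pt w1 w2 i n))) <= 
     D / (c * N.+1%:R) ^+ 2 + D / (c * N.+1%:R) ^+ 2 by [].
  under eq_bigr => m _ do rewrite l1.
  rewrite (telescope_int_box (fun m => F (lattice_pt w1 w2 m n))).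
  by apply: le_trans (cabsB _ _) _; apply: lerD; apply: side; lia.
apply: main => m; under eq_bigr => n _ do rewrite l2.
rewrite (telescope_int_box (fun n => F (lattice_pt w1 w2 m n))).
by apply: le_trans (cabsB _ _) _; apply: lerD; apply: side; lia.
Qed.

Lemma seq_gap (s : seq C) : (forall x, x \in s -> x != 0) ->
  exists2 d : R, 0 < d & forall x, x \in s -> d <= cabs x.
Proof.
elim: s => [|y s IH] H; first by exists 1.
have [|d d0 hd] := IH; first by move=> x xs; apply: H; rewrite inE xs orbT.
have y0 : 0 < cabs y by rewrite cabs_gt0 H // mem_head.
exists (Num.min d (cabs y)); first by rewrite lt_min d0.
move=> x; rewrite inE ge_min => /orP[/eqP ->|/hd ->//]; by rewrite lexx orbT.
Qed.

(** Nonvanishing and linear growth of [z + w] in one constant: the triangle inequality settles all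
    large [w], and finitely many remain. It is used with [P] always true for [z] off the lattice,
    and with [P] excluding 0 for [z = 0]. *)
Lemma lattice_gap (P : pred C) (z : C) : (forall w, L w -> P w -> z + w != 0) ->
  exists2 d : R, 0 < d & forall w, L w -> P w -> d * (1 + cabs w) <= cabs (z + w).
Proof.
move=> zP; have z0 := cabs_ge0 z; have [c /andP[c0 c1] H] := lattice_pt_bound w2_neq0 w12.
(* For [|w| >= B] one has [|z + w| >= |w| - |z| >= (1 + |w|) / 2]. *)
pose B := 2 * cabs z + 1.
pose N := Num.bound (B / c).
have small w : L w -> cabs w < B -> w \in box N.
  move=> [m [n e]] hw; rewrite [w]e -/(lattice_pt w1 w2 m n) mem_box //.
  have h : c * (`|m| + `|n|)%N%:R <= B.
    by rewrite natrD; apply: le_trans (H m n) _; rewrite -[lattice_pt _ _ _ _]e ltW.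
  have B0 : 0 <= B / c by rewrite divr_ge0 // ?ltW // /B; lra.
  have := archi_boundP B0; rewrite ltr_pdivrMr // -/N => h2.
  have : (`|m| + `|n|)%N%:R < N%:R :> R by rewrite -(ltr_pM2l c0) (mulrC c N%:R); lra.
  by rewrite ltr_nat; lia.
have [|d d0 hd] := @seq_gap [seq z + w | w <- box N & P w].
  move=> x /mapP[w]; rewrite mem_filter => /andP[Pw /box_lattice wL] ->; exact: zP.
pose d' := Num.min 4^-1 (d / (1 + B)).
have B1 : 0 < 1 + B by rewrite /B; lra.
exists d'; first by rewrite lt_min divr_gt0 // andbT; lra.
move=> w wL Pw; have w0 := cabs_ge0 w.
have [wB|wB] := ltP (cabs w) B.
  apply: (@le_trans _ _ (d / (1 + B) * (1 + cabs w))).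
    by rewrite ler_wpM2r ?ge_min ?lexx ?orbT //; lra.
  apply: (@le_trans _ _ d).
    rewrite mulrAC ler_pdivrMr // ler_pM2l //; lra.
  by apply: hd; apply/mapP; exists w => //; rewrite mem_filter Pw small.
apply: (@le_trans _ _ (4^-1 * (1 + cabs w))).
  by rewrite ler_wpM2r ?ge_min ?lexx //; lra.
by have := lerB_cabsD w z; rewrite (addrC w); move: wB; rewrite /B; lra.
Qed.

End LatticeSumTheory.

(** * Second-order Taylor expansions *)

Section Jets.
Variable R : realType.
Local Notation C := (Cplx R).
Implicit Types (f g : C -> C) (z a b c h : C).

(** Two orders are kept because a cubic error is beaten by the quadratic gain in [no_interior_max];
    the first coefficient already determines the derivative. *)
Definition jet2 f z a b c := exists K r : R, [/\ 0 <= K, 0 < r &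
  forall h, cabs h < r -> cabs (f (z + h) - (a + b * h + c * h ^+ 2)) <= K * cabs h ^+ 3].

Lemma jet2_val f z a b c : jet2 f z a b c -> f z = a.
Proof.
move=> [K [r [K0 r0 H]]]; have := H 0; rewrite cabs0 => /(_ r0).
rewrite !expr0n /= !mulr0 !addr0 => h.
by apply/eqP; rewrite -subr_eq0 -cabs_eq0 eq_le h cabs_ge0.
Qed.

Lemma jet2_near f g z a b c (r : R) : 0 < r ->
  (forall h, cabs h < r -> f (z + h) = g (z + h)) -> jet2 f z a b c -> jet2 g z a b c.
Proof.
move=> r0 fg [K [s [K0 s0 H]]]; exists K, (Num.min r s); split => //.
  by rewrite lt_min r0.
by move=> h; rewrite lt_min => /andP[/fg <- /H].
Qed.

Lemma jet2_ext f g z a b c : f =1 g -> jet2 f z a b c -> jet2 g z a b c.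
Proof. by move=> fg; apply: (@jet2_near _ _ _ _ _ _ 1). Qed.

Lemma jet2_cst k z : jet2 (fun=> k) z k 0 0.
Proof.
exists 0, 1; split => // h _.
by rewrite !mul0r !addr0 subrr cabs0.
Qed.

Lemma jet2_id z : jet2 id z z 1 0.
Proof.
exists 0, 1; split => // h _.
by rewrite !mul0r mul1r !addr0 subrr cabs0.
Qed.

Lemma jet2_shift f u z a b c : jet2 f (z + u) a b c -> jet2 (fun y => f (y + u)) z a b c.
Proof.
move=> [K [r [K0 r0 H]]]; exists K, r; split => // h /H.
by rewrite addrAC.
Qed.

Lemma jet2D f g z a b c a' b' c' : jet2 f z a b c -> jet2 g z a' b' c' ->
  jet2 (fun y => f y + g y) z (a + a') (b + b') (c + c').
Proof.
move=> [K [r [K0 r0 H]]] [K' [r' [K0' r0' H']]].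
exists (K + K'), (Num.min r r'); split; [lra|by rewrite lt_min r0|].
move=> h; rewrite lt_min => /andP[/H h1 /H' h2].
set A := f _ - _ in h1; set B := g _ - _ in h2.
rewrite (_ : _ - _ = A + B); last by rewrite /A /B; ring.
by apply: le_trans (cabsD _ _) _; lra.
Qed.

Lemma jet2M f g z a b c a' b' c' : jet2 f z a b c -> jet2 g z a' b' c' ->
  jet2 (fun y => f y * g y) z (a * a') (a * b' + b * a') (a * c' + b * b' + c * a').
Proof.
move=> [K [r [K0 r0 H]]] [K' [r' [K0' r0' H']]].
pose N := cabs a + cabs b + cabs c; pose N' := cabs a' + cabs b' + cabs c'.
have N0 : 0 <= N by rewrite /N !addr_ge0 ?cabs_ge0.
have N0' : 0 <= N' by rewrite /N' !addr_ge0 ?cabs_ge0.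
(* [M] collects the coefficients of [h ^ 3] and [h ^ 4] in the product of the two quadratics; a
   radius at most 1 lets higher powers of [h] be absorbed in [h ^ 3]. *)
pose M := cabs b * cabs c' + cabs c * cabs b' + cabs c * cabs c'.
have M0 : 0 <= M by rewrite /M !addr_ge0 // mulr_ge0 ?cabs_ge0.
exists (M + N * K' + K * N' + K * K'), (Num.min 1 (Num.min r r')); split.
- by do !apply: addr_ge0 => //; apply: mulr_ge0 => //; exact: ltW.
- by rewrite !lt_min ltr01 r0.
move=> h; rewrite !lt_min => /and3P[h1 /H hE /H' hF].
have bnd (p q s : C) : cabs (p + q * h + s * h ^+ 2) <= cabs p + cabs q + cabs s.
  have := cabs_ge0 h; have := cabs_ge0 q; have := cabs_ge0 s => s0 q0 h0.
  apply: le_trans (cabsD _ _) _; apply: lerD.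
    apply: le_trans (cabsD _ _) _; rewrite cabsM lerD2l.
    by apply: ler_piMr => //; exact: ltW.
  by rewrite cabsM cabsX; apply: ler_piMr => //; rewrite expr_le1 // ltW.
have hP := bnd a b c; have hQ := bnd a' b' c'.
set P := a + _ + _ in hE hP; set Q := a' + _ + _ in hF hQ.
set E := f _ - P in hE; set F := g _ - Q in hF.
rewrite (_ : _ - _ = h ^+ 3 * (b * c' + c * b' + c * c' * h) + (P * F + E * Q + E * F)); last first.
  by rewrite /E /F /P /Q; ring.
have h0 := cabs_ge0 h; set H3 := cabs h ^+ 3 in hE hF *.
have H30 : 0 <= H3 by rewrite exprn_ge0.
have H31 : H3 <= 1 by rewrite expr_le1 // ltW.
have t1 : cabs (h ^+ 3 * (b * c' + c * b' + c * c' * h)) <= M * H3.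
  rewrite cabsM cabsX -/H3 mulrC ler_wpM2r //.
  apply: le_trans (cabsD _ _) _; apply: lerD.
    by apply: le_trans (cabsD _ _) _; rewrite !cabsM.
  by rewrite !cabsM; apply: ler_piMr; [rewrite mulr_ge0 ?cabs_ge0|exact: ltW].
have t2 : cabs (P * F) <= N * K' * H3.
  by rewrite cabsM -mulrA ler_pM ?cabs_ge0.
have t3 : cabs (E * Q) <= K * N' * H3.
  by rewrite cabsM mulrAC ler_pM ?cabs_ge0.
have t4 : cabs (E * F) <= K * K' * H3.
  rewrite cabsM -mulrA; apply: ler_pM; rewrite ?cabs_ge0 //.
  by apply: le_trans hE _; rewrite ler_piMr.
have := cabsD (h ^+ 3 * (b * c' + c * b' + c * c' * h)) (P * F + E * Q + E * F).
have := cabsD (P * F + E * Q) (E * F); have := cabsD (P * F) (E * Q).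
have -> : (M + N * K' + K * N' + K * K') * H3 =
  M * H3 + N * K' * H3 + K * N' * H3 + K * K' * H3 by rewrite !mulrDl.
lra.
Qed.

Lemma jet2V z : z != 0 -> jet2 (fun y => y^-1) z z^-1 (- z ^- 2) (z ^- 3).
Proof.
move=> z0; have c0 : 0 < cabs z by rewrite cabs_gt0.
(* The remainder is exactly [- h ^ 3 / (z ^ 3 (z + h))], and [|z + h| >= |z| / 2] on this disc. *)
exists (2 / cabs z ^+ 4), (cabs z / 2); split.
- by rewrite divr_ge0 // exprn_ge0 // ltW.
- by rewrite divr_gt0.
move=> h hz; have hh : cabs z / 2 <= cabs (z + h).
  by have := lerB_cabsD z h; lra.
have zh : z + h != 0 by rewrite -cabs_gt0; lra.
rewrite (_ : _ - _ = - (h ^+ 3 / (z ^+ 3 * (z + h)))); last first.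
  by field; rewrite ?z0 ?zh ?andbT; split.
rewrite cabsN !(cabsM, cabsV, cabsX) mulrC ler_wpM2r ?exprn_ge0 ?cabs_ge0 //.
rewrite -(invf_div (cabs z ^+ 4)) lef_pV2 ?posrE ?mulr_gt0 ?divr_gt0 ?exprn_gt0 ?cabs_gt0 //.
  by rewrite exprSr -mulrA ler_pM2l // exprn_gt0.
by rewrite invr_gt0.
Qed.

Definition has_jet2 f z := exists a b c, jet2 f z a b c.

Lemma has_jet2_ext f g z : f =1 g -> has_jet2 f z -> has_jet2 g z.
Proof. by move=> fg [a [b [c /(jet2_ext fg) h]]]; exists a, b, c. Qed.

Lemma has_jet2_near f g z (r : R) : 0 < r ->
  (forall h, cabs h < r -> f (z + h) = g (z + h)) -> has_jet2 f z -> has_jet2 g z.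
Proof. by move=> r0 fg [a [b [c /(jet2_near r0 fg) h]]]; exists a, b, c. Qed.

Lemma has_jet2_cst k z : has_jet2 (fun=> k) z.
Proof. by do 3 eexists; exact: jet2_cst. Qed.

Lemma has_jet2_id z : has_jet2 id z.
Proof. by do 3 eexists; exact: jet2_id. Qed.

Lemma has_jet2V z : z != 0 -> has_jet2 (fun y => y^-1) z.
Proof. by do 3 eexists; exact: jet2V. Qed.

Lemma has_jet2D f g z : has_jet2 f z -> has_jet2 g z -> has_jet2 (fun y => f y + g y) z.
Proof.
move=> [a [b [c h]]] [a' [b' [c' h']]]; do 3 eexists; exact: jet2D h h'.
Qed.

Lemma has_jet2M f g z : has_jet2 f z -> has_jet2 g z -> has_jet2 (fun y => f y * g y) z.
Proof.
move=> [a [b [c h]]] [a' [b' [c' h']]]; do 3 eexists; exact: jet2M h h'.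
Qed.

Lemma has_jet2X f z n : has_jet2 f z -> has_jet2 (fun y => f y ^+ n) z.
Proof.
move=> h; elim: n => [|n IH]; first exact: has_jet2_cst.
by apply: has_jet2_ext (has_jet2M h IH) => y; rewrite exprS.
Qed.

Lemma has_jet2_shift f u z : has_jet2 f (z + u) -> has_jet2 (fun y => f (y + u)) z.
Proof. by move=> [a [b [c /jet2_shift h]]]; exists a, b, c. Qed.

Lemma has_jet2_cont f z : has_jet2 f z -> forall e : R, 0 < e ->
  exists2 r : R, 0 < r & forall y, cabs (y - z) < r -> cabs (f y - f z) < e.
Proof.
move=> [a [b [c hj]]]; have fz := jet2_val hj; move: hj => [K [r [K0 r0 H]]] e e0.
pose M := cabs b + cabs c + K + 1.
have b0 := cabs_ge0 b; have c0 := cabs_ge0 c.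
have M0 : 0 < M by rewrite /M; lra.
exists (Num.min (Num.min 1 r) (e / M)); first by rewrite !lt_min ltr01 r0 divr_gt0.
move=> y; rewrite !lt_min -andbA => /and3P[].
have -> : y = z + (y - z) by rewrite addrC subrK.
move: (y - z) => h; rewrite addrC addKr => h1 /H hf he.
have h0 := cabs_ge0 h.
rewrite fz; set E := f _ - _ in hf.
rewrite [z + h]addrC in E hf *.
rewrite (_ : _ - _ = E + h * (b + c * h)); last by rewrite /E; ring.
have p2 : cabs h ^+ 2 <= 1 by rewrite expr_le1 // ltW.
have p3 : cabs h ^+ 3 <= cabs h by rewrite exprS; apply: ler_piMr.
rewrite ltr_pdivlMr // in he.
apply: le_lt_trans he; apply: le_trans (cabsD _ _) _.
have q1 : cabs E <= K * cabs h by apply: le_trans hf _; rewrite ler_wpM2l.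
have q2 : cabs (h * (b + c * h)) <= cabs h * (cabs b + cabs c).
  rewrite cabsM ler_wpM2l //; apply: le_trans (cabsD _ _) _.
  by rewrite cabsM lerD2l ler_piMr // ltW.
rewrite /M; lra.
Qed.

Lemma jet2_derive f z a b c : jet2 f z a b c ->
  h^-1 *: (f (h + z) - f z) @[h --> 0^'] --> b.
Proof.
move=> hj; have fz := jet2_val hj; move: hj => [K [r [K0 r0 H]]].
apply: cvg_to_cabsP => e e0; apply/dnear_cabsP.
have c0 := cabs_ge0 c.
have M0 : 0 < cabs c + K + 1 by lra.
exists (Num.min (Num.min 1 r) (e / (cabs c + K + 1))); first by rewrite !lt_min ltr01 r0 divr_gt0.
move=> h hn0; rewrite subr0 !lt_min -andbA => /and3P[h1 /H hf he].
have h0 : 0 < cabs h by rewrite cabs_gt0.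
rewrite fz [h + z]addrC; set E := f _ - _ in hf.
rewrite (_ : _ - b = h^-1 * E + c * h); last first.
  by rewrite /E /GRing.scale /=; field.
rewrite ltr_pdivlMr // in he.
apply: le_lt_trans he; apply: le_trans (cabsD _ _) _.
rewrite !cabsM cabsV.
have q1 : (cabs h)^-1 * cabs E <= K * cabs h.
  rewrite ler_pdivrMl //; apply: le_trans hf _.
  rewrite [leRHS]mulrCA ler_wpM2l // exprS; apply: ler_wpM2l; first exact: ltW.
  by rewrite expr2; apply: ler_piMr; exact: ltW.
lra.
Qed.

Lemma jet2_derivable f z a b c : jet2 f z a b c -> derivable f z 1.
Proof.
move=> /jet2_derive H; apply/cvg_ex; exists b.
apply: cvg_trans H; apply: near_eq_cvg; near=> h => /=.
by rewrite /GRing.scale /= mulr1.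
Unshelve. all: by end_near. Qed.

Lemma jet2_derive1 f z a b c : jet2 f z a b c -> derive1 f z = b.
Proof. by move=> /jet2_derive H; apply: cvg_lim H; exact: norm_hausdorff. Qed.

Lemma has_jet2_holomorphic f z (r : R) : 0 < r ->
  (forall y, cabs (y - z) < r -> has_jet2 f y) -> holomorphic_at f z.
Proof.
move=> r0 H; apply/near_cabsP; exists r => // y /H [a [b [c]]].
exact: jet2_derivable.
Qed.

End Jets.

(** * Lattice sums of inverse powers *)

Section Remainders.
Variable R : realType.
Local Notation C := (Cplx R).
Implicit Types u h : C.

Lemma half_shift u h : u != 0 -> cabs h <= cabs u / 2 ->
  [/\ u + h != 0, 0 < cabs u & cabs u / 2 <= cabs (u + h)].
Proof.
move=> u0 hu; have U0 : 0 < cabs u by rewrite cabs_gt0.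
have V : cabs u / 2 <= cabs (u + h) by have := lerB_cabsD u h; lra.
by split => //; rewrite -cabs_gt0; lra.
Qed.

(** The Taylor remainders of [u ^- m] below are closed fractions of this shape, with [p] homogeneous
    of degree [j] in [u] and [h]; the factor [2 ^ m] comes from [|u + h| >= |u| / 2]. *)
Lemma remainder_bound u h p (A : R) k j m n : u != 0 -> cabs h <= cabs u / 2 ->
  cabs p <= A * cabs u ^+ j ->
  cabs (h ^+ k * p / (u ^+ n * (u + h) ^+ m)) <=
    A * 2 ^+ m * cabs h ^+ k * (cabs u ^+ j / (cabs u ^+ n * cabs u ^+ m)).
Proof.
move=> u0 hu hp; have [uh0 U0 V] := half_shift u0 hu.
have V0 : 0 < cabs (u + h) by rewrite cabs_gt0.
rewrite !(cabsM, cabsV, cabsX) -!mulrA (mulrCA _ (cabs h ^+ k)) (mulrCA A).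
rewrite ler_wpM2l ?exprn_ge0 ?cabs_ge0 //.
rewrite (mulrCA (2 ^+ m)) mulrA.
apply: ler_pM; rewrite ?cabs_ge0 ?invr_ge0 ?mulr_ge0 ?exprn_ge0 ?cabs_ge0 //.
rewrite !invfM mulrCA ler_wpM2l ?invr_ge0 ?exprn_ge0 ?cabs_ge0 //.
have -> : 2 ^+ m / cabs u ^+ m = ((cabs u / 2) ^+ m)^-1 :> R.
  by rewrite expr_div_n invf_div.
rewrite lef_pV2 ?posrE ?exprn_gt0 //; last lra.
by apply: lerXn2r => //; rewrite nnegrE ?cabs_ge0 //; lra.
Qed.

(** The constant is [2 ^ m] times the bound of [p] obtained from [|h| <= |u| / 2], here
    [4 + 3 / 2 = 11 / 2]. The next three constants arise in the same way, 59 / 2 being rounded up to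
    30 in [inv3_taylor]. *)
Lemma inv2_jet u h : u != 0 -> cabs h <= cabs u / 2 ->
  cabs ((u + h) ^- 2 - (u ^- 2 - 2 * h * u ^- 3 + 3 * h ^+ 2 * u ^- 4)) <=
    22 * cabs h ^+ 3 * cabs u ^- 5.
Proof.
move=> u0 hu; have [uh0 U0 V] := half_shift u0 hu.
have := @remainder_bound u h (4 * u + 3 * h) (11 / 2) 3 1 2 4 u0 hu.
have -> : 11 / 2 * 2 ^+ 2 = 22 :> R by field.
have -> : cabs u ^+ 1 / (cabs u ^+ 4 * cabs u ^+ 2) = cabs u ^- 5 by field; rewrite gt_eqF.
move=> H.
rewrite (_ : _ - _ = - (h ^+ 3 * (4 * u + 3 * h) / (u ^+ 4 * (u + h) ^+ 2))); last first.
  by field; rewrite ?u0 ?uh0.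
rewrite cabsN; apply: H; apply: le_trans (cabsD _ _) _; rewrite !cabsM !cabs_nat expr1; lra.
Qed.

Lemma inv3_jet u h : u != 0 -> cabs h <= cabs u / 2 ->
  cabs ((u + h) ^- 3 - (u ^- 3 - 3 * h * u ^- 4 + 6 * h ^+ 2 * u ^- 5)) <=
    152 * cabs h ^+ 3 * cabs u ^- 6.
Proof.
move=> u0 hu; have [uh0 U0 V] := half_shift u0 hu.
have := @remainder_bound u h (10 * u ^+ 2 + 15 * u * h + 6 * h ^+ 2) 19 3 2 3 5 u0 hu.
have -> : 19 * 2 ^+ 3 = 152 :> R by ring.
have -> : cabs u ^+ 2 / (cabs u ^+ 5 * cabs u ^+ 3) = cabs u ^- 6 by field; rewrite gt_eqF.
move=> H.
rewrite (_ : _ - _ = - (h ^+ 3 * (10 * u ^+ 2 + 15 * u * h + 6 * h ^+ 2) / (u ^+ 5 * (u + h) ^+ 3))); last first.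
  by field; rewrite ?u0 ?uh0.
rewrite cabsN; apply: H; have h0 := cabs_ge0 h.
apply: le_trans (cabsD _ _) _; rewrite [cabs (6 * _)]cabsM cabsX cabs_nat.
have := cabsD (10 * u ^+ 2) (15 * u * h); rewrite !cabsM ?cabsX !cabs_nat.
nra.
Qed.

Lemma inv2_taylor u h : u != 0 -> cabs h <= cabs u / 2 ->
  cabs ((u + h) ^- 2 - (u ^- 2 - 2 * h * u ^- 3 + 3 * h ^+ 2 * u ^- 4
     - 4 * h ^+ 3 * u ^- 5 + 5 * h ^+ 4 * u ^- 6)) <= 34 * cabs h ^+ 5 * cabs u ^- 7.
Proof.
move=> u0 hu; have [uh0 U0 V] := half_shift u0 hu.
have := @remainder_bound u h (6 * u + 5 * h) (17 / 2) 5 1 2 6 u0 hu.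
have -> : 17 / 2 * 2 ^+ 2 = 34 :> R by field.
have -> : cabs u ^+ 1 / (cabs u ^+ 6 * cabs u ^+ 2) = cabs u ^- 7 by field; rewrite gt_eqF.
move=> H.
rewrite (_ : _ - _ = - (h ^+ 5 * (6 * u + 5 * h) / (u ^+ 6 * (u + h) ^+ 2))); last first.
  by field; rewrite ?u0 ?uh0.
rewrite cabsN; apply: H; apply: le_trans (cabsD _ _) _; rewrite !cabsM !cabs_nat expr1; lra.
Qed.

Lemma inv3_taylor u h : u != 0 -> cabs h <= cabs u / 2 ->
  cabs ((u + h) ^- 3 - (u ^- 3 - 3 * h * u ^- 4 + 6 * h ^+ 2 * u ^- 5
     - 10 * h ^+ 3 * u ^- 6)) <= 240 * cabs h ^+ 4 * cabs u ^- 7.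
Proof.
move=> u0 hu; have [uh0 U0 V] := half_shift u0 hu.
have := @remainder_bound u h (15 * u ^+ 2 + 24 * u * h + 10 * h ^+ 2) 30 4 2 3 6 u0 hu.
have -> : 30 * 2 ^+ 3 = 240 :> R by ring.
have -> : cabs u ^+ 2 / (cabs u ^+ 6 * cabs u ^+ 3) = cabs u ^- 7 by field; rewrite gt_eqF.
move=> H.
rewrite (_ : _ - _ = h ^+ 4 * (15 * u ^+ 2 + 24 * u * h + 10 * h ^+ 2) / (u ^+ 6 * (u + h) ^+ 3)); last first.
  by field; rewrite ?u0 ?uh0.
apply: H; have h0 := cabs_ge0 h.
apply: le_trans (cabsD _ _) _; rewrite [cabs (10 * _)]cabsM cabsX cabs_nat.
have := cabsD (15 * u ^+ 2) (24 * u * h); rewrite !cabsM ?cabsX !cabs_nat.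
nra.
Qed.

End Remainders.

(** * Lattice series restricted by a predicate: jets, expansions at 0, periodicity *)

Section LatticeFunctions.
Variables (R : realType) (w1 w2 : Cplx R).
Hypothesis (w2_neq0 : w2 != 0) (w12 : w1 / w2 \isn't Num.real).
Local Notation C := (Cplx R).
Local Notation L := (lattice w1 w2).
Local Notation box_cvg := (box_cvg w1 w2).
Local Notation dominated := (dominated w1 w2).
Implicit Types (P : pred C) (z h w : C).

(** The predicate treats two situations at once: [predT] gives the full series off the lattice,
    [nonzero] the part that stays regular at the origin once the pole is removed. *)
Definition inv_pow_term P k z w : C := if P w then (z + w) ^- k else 0.
Definition wp_term P z w : C := if P w then (z + w) ^- 2 - w ^- 2 else 0.

(* As [0^-1 = 0], the term of [wp_sum] at the origin is [z ^- 2] when [P 0] holds. *)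
Definition inv_pow_sum P k z : C := lattice_sum w1 w2 (inv_pow_term P k z) + inv_pow_term P k z 0.
Definition wp_sum P z : C := lattice_sum w1 w2 (wp_term P z) + wp_term P z 0.

(** This bound survives small changes of [z] ([gap_near]), so the termwise estimates are uniform
    near [z]. *)
Definition gap P z (d : R) :=
  0 < d /\ forall w, L w -> P w -> d * (1 + cabs w) <= cabs (z + w).

Definition nonzero : pred C := fun w => w != 0.

Lemma lattice_sum_ext (F G : C -> C) : (forall w, w != 0 -> F w = G w) ->
  lattice_sum w1 w2 F = lattice_sum w1 w2 G.
Proof.
move=> FG; rewrite /lattice_sum; congr (summability.sum _).
apply/funext => w; rewrite /patch; case: ifP => //.
by rewrite in_setD => /andP[_ /negP w0]; apply: FG; apply/eqP => e; apply: w0; exact/mem_set.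
Qed.

Lemma wpE z : wp w1 w2 z = wp_sum predT z.
Proof. by rewrite /wp /wp_sum /wp_term /= addr0 expr0n /= invr0 subr0 addrC. Qed.

Lemma wp_sum_split z : wp_sum predT z = z ^- 2 + wp_sum nonzero z.
Proof.
rewrite /wp_sum {2 4}/wp_term /= /nonzero eqxx /= !addr0 expr0n /= invr0 subr0 addrC; congr (_ + _).
by apply: lattice_sum_ext => w w0; rewrite /wp_term /nonzero w0.
Qed.

Lemma inv_pow_sum_split k z : inv_pow_sum predT k z = z ^- k + inv_pow_sum nonzero k z.
Proof.
rewrite /inv_pow_sum {2 4}/inv_pow_term /= /nonzero eqxx /= !addr0 addrC; congr (_ + _).
by apply: lattice_sum_ext => w w0; rewrite /inv_pow_term /nonzero w0.
Qed.

Lemma eisensteinE k : eisenstein w1 w2 k = inv_pow_sum nonzero k 0.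
Proof.
rewrite /inv_pow_sum {2}/inv_pow_term /nonzero eqxx /= addr0.
by apply: lattice_sum_ext => w w0; rewrite /inv_pow_term /nonzero w0 add0r.
Qed.

Lemma gap_neq0 P z d w : gap P z d -> L w -> P w -> z + w != 0.
Proof.
move=> [d0 H] wL Pw; have := H w wL Pw; have w0 := cabs_ge0 w.
by rewrite -cabs_gt0; apply: lt_le_trans; rewrite mulr_gt0 //; lra.
Qed.

Lemma gap_ge P z d w : gap P z d -> L w -> P w -> d <= cabs (z + w).
Proof.
move=> [d0 H] wL Pw; have := H w wL Pw; have w0 := cabs_ge0 w.
by apply: le_trans; rewrite ler_peMr //; [exact: ltW | lra].
Qed.

Lemma gap_near P z d h : gap P z d -> cabs h < d / 2 -> gap P (z + h) (d / 2).
Proof.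
move=> g hd; have [d0 H] := g; split; first lra.
move=> w wL Pw; have := gap_ge g wL Pw; have := H w wL Pw.
by have := lerB_cabsD (z + w) h; rewrite addrAC; lra.
Qed.

Lemma gap_pow P z d w k : gap P z d -> L w -> P w ->
  cabs (z + w) ^- k <= d ^- k * (1 + cabs w) ^- k.
Proof.
move=> g wL Pw; have [d0 H] := g; have w0 := cabs_ge0 w.
have zw : 0 < cabs (z + w) by rewrite cabs_gt0 (gap_neq0 g).
have w1' : 0 < 1 + cabs w by lra.
rewrite -invfM -exprMn lef_pV2 ?posrE ?exprn_gt0 ?mulr_gt0 //.
by apply: lerXn2r; rewrite ?nnegrE ?(ltW zw) ?H // mulr_ge0 // ltW.
Qed.

Lemma pow_le_weight k w : (3 <= k)%N -> (1 + cabs w) ^- k <= weight w.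
Proof.
move=> k3; have w0 := cabs_ge0 w.
rewrite /weight lef_pV2 ?posrE ?exprn_gt0 //; try lra.
by apply: ler_weXn2l => //; lra.
Qed.

Lemma gap_weight P z d w k : gap P z d -> L w -> P w -> (3 <= k)%N ->
  cabs (z + w) ^- k <= d ^- k * weight w.
Proof.
move=> g wL Pw k3; apply: le_trans (gap_pow k g wL Pw) _.
by rewrite ler_wpM2l ?pow_le_weight // invr_ge0 exprn_ge0 // ltW //; case: g.
Qed.

Lemma inv_pow_term_dominated P z d k : gap P z d -> (3 <= k)%N -> dominated (inv_pow_term P k z) (d ^- k).
Proof.
move=> g k3 w wL; rewrite /inv_pow_term; case: ifP => Pw.
  by rewrite cabsV cabsX (gap_weight g).
by rewrite cabs0 mulr_ge0 ?(ltW (weight_gt0 _)) // invr_ge0 exprn_ge0 // ltW //; case: g.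
Qed.

Lemma inv_pow_term_cvg P z d k : gap P z d -> (3 <= k)%N -> box_cvg (inv_pow_term P k z) (inv_pow_sum P k z).
Proof.
move=> g k3; have D := inv_pow_term_dominated g k3.
have [l hl] := dominated_box_cvg w2_neq0 w12 D.
by rewrite /inv_pow_sum (box_cvg_lattice_sum w2_neq0 w12 D hl) subrK.
Qed.

Lemma nonzero_gap0 : exists d, gap nonzero 0 d.
Proof.
have [|d d0 H] := @lattice_gap _ w1 w2 w2_neq0 w12 nonzero 0.
  by move=> w _; rewrite add0r.
by exists d.
Qed.

(** The subtraction gains one power: the difference is [- z (z + 2 w) / ((z + w) ^ 2 w ^ 2)], whose
    numerator is only linear in [w]. *)
Lemma wp_term_dominated P z d : gap P z d -> exists D, dominated (wp_term P z) D.
Proof.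
move=> g; have [d0 _] := g; have [b gb] := nonzero_gap0; have [b0 _] := gb.
have z0 := cabs_ge0 z.
pose D1 := cabs z * (cabs z + 2) * (d ^- 2 * b ^- 2).
have D10 : 0 <= D1 by rewrite /D1 !mulr_ge0 ?invr_ge0 ?exprn_ge0 ?addr_ge0 // ltW.
(* The identity needs [w != 0]; the second summand takes care of the origin, where [weight] is 1. *)
exists (D1 + cabs (wp_term P z 0)) => w wL.
have W := weight_gt0 w.
rewrite mulrDl.
have [->|w0] := eqVneq w 0.
  rewrite ler_wpDl //; first by rewrite mulr_ge0 // ltW // weight_gt0.
  by rewrite /weight cabs0 addr0 expr1n invr1 mulr1.
rewrite ler_wpDr //; first by rewrite mulr_ge0 ?cabs_ge0 // ltW.
rewrite /wp_term; case: ifP => Pw; last by rewrite cabs0 mulr_ge0 // ltW.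
have zw := gap_neq0 g wL Pw.
rewrite (_ : _ - _ = - (z * (z + 2 * w)) * ((z + w) ^- 2 * w ^- 2)); last first.
  by field; rewrite w0 zw.
rewrite cabsM cabsN !cabsM !cabsV !cabsX.
have h1 := gap_pow 2 g wL Pw; have h2 := gap_pow 2 gb wL w0.
rewrite add0r in h2.
have c0 := cabs_ge0 w; have h3 : cabs (z + 2 * w) <= (cabs z + 2) * (1 + cabs w).
  by apply: le_trans (cabsD _ _) _; rewrite cabsM cabs_nat; nra.
have h4 : cabs (z + w) ^- 2 * cabs w ^- 2 <= d ^- 2 * (1 + cabs w) ^- 2 * (b ^- 2 * (1 + cabs w) ^- 2).
  by apply: ler_pM; rewrite ?invr_ge0 ?exprn_ge0 ?cabs_ge0.
apply: (@le_trans _ _ (cabs z * ((cabs z + 2) * (1 + cabs w)) * (d ^- 2 * (1 + cabs w) ^- 2 * (b ^- 2 * (1 + cabs w) ^- 2)))).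
  apply: ler_pM => //; rewrite ?mulr_ge0 ?invr_ge0 ?exprn_ge0 ?cabs_ge0 //.
  by rewrite ler_wpM2l.
rewrite /D1 /weight; have x0 : 1 + cabs w != 0 by rewrite gt_eqF //; lra.
suff -> : cabs z * ((cabs z + 2) * (1 + cabs w)) * (d ^- 2 * (1 + cabs w) ^- 2 * (b ^- 2 * (1 + cabs w) ^- 2)) =
  cabs z * (cabs z + 2) * (d ^- 2 * b ^- 2) * (1 + cabs w) ^- 3 by [].
by field; rewrite x0 (gt_eqF b0) (gt_eqF d0).
Qed.

Lemma wp_term_cvg P z d : gap P z d -> box_cvg (wp_term P z) (wp_sum P z).
Proof.
move=> g; have [D HD] := wp_term_dominated g.
have [l hl] := dominated_box_cvg w2_neq0 w12 HD.
by rewrite /wp_sum (box_cvg_lattice_sum w2_neq0 w12 HD hl) subrK.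
Qed.

(** The remainder of [inv3_jet] at [u = z + w] is at most [152 d ^- 6 |h| ^ 3 weight w], and
    [box_cvg_bound] sums these. *)
Lemma inv_pow_sum3_jet P z d : gap P z d ->
  jet2 (inv_pow_sum P 3) z (inv_pow_sum P 3 z) (- 3 * inv_pow_sum P 4 z) (6 * inv_pow_sum P 5 z).
Proof.
move=> g; have [d0 _] := g; have [K K0 HK] := box_cvg_bound w2_neq0 w12.
exists (152 * d ^- 6 * K), (d / 2); split.
- by rewrite !mulr_ge0 ?invr_ge0 ?exprn_ge0 // ltW.
- lra.
move=> h hd; have h0 := cabs_ge0 h.
have H1 := inv_pow_term_cvg (gap_near g hd) (leqnn 3).
have H2 : box_cvg (fun w => inv_pow_term P 3 z w + (-3 * h) * inv_pow_term P 4 z w + (6 * h ^+ 2) * inv_pow_term P 5 z w)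
    (inv_pow_sum P 3 z + -3 * inv_pow_sum P 4 z * h + 6 * inv_pow_sum P 5 z * h ^+ 2).
  have := box_cvgD (box_cvgD (inv_pow_term_cvg g (leqnn 3)) (box_cvgZ (-3 * h) (inv_pow_term_cvg g (isT : (3 <= 4)%N))))
    (box_cvgZ (6 * h ^+ 2) (inv_pow_term_cvg g (isT : (3 <= 5)%N))).
  by rewrite (mulrAC (-3)) (mulrAC 6).
rewrite [leRHS]mulrAC; apply: (HK _ _ _ _ (box_cvgB H1 H2)) => w wL.
have W := weight_gt0 w; rewrite /inv_pow_term; case: ifP => Pw; last first.
  rewrite !mulr0 !addr0 subrr cabs0; apply: mulr_ge0; last exact: ltW.
  by rewrite !mulr_ge0 ?invr_ge0 ?exprn_ge0 // ltW.
have zw := gap_neq0 g wL Pw; have gz := gap_ge g wL Pw.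
have hz : cabs h <= cabs (z + w) / 2 by lra.
have := inv3_jet zw hz; rewrite [z + w + h]addrAC => B.
rewrite (_ : _ - (_ + _ + _) = (z + h + w) ^- 3 - ((z + w) ^- 3 - 3 * h * (z + w) ^- 4 + 6 * h ^+ 2 * (z + w) ^- 5)); last by ring.
apply: le_trans B _.
rewrite (mulrAC 152 (d ^- 6)) -[leRHS]mulrA ler_wpM2l ?mulr_ge0 ?exprn_ge0 //.
exact: (gap_weight g).
Qed.

(** The same scheme with [inv2_jet]; its linear coefficient identifies [dwp] with a multiple of the
    series of inverse cubes. *)
Lemma wp_sum_jet P z d : gap P z d ->
  jet2 (wp_sum P) z (wp_sum P z) (- 2 * inv_pow_sum P 3 z) (3 * inv_pow_sum P 4 z).
Proof.
move=> g; have [d0 _] := g; have [K K0 HK] := box_cvg_bound w2_neq0 w12.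
exists (22 * d ^- 5 * K), (d / 2); split.
- by rewrite !mulr_ge0 ?invr_ge0 ?exprn_ge0 // ltW.
- lra.
move=> h hd; have h0 := cabs_ge0 h.
have H1 := wp_term_cvg (gap_near g hd).
have H2 : box_cvg (fun w => wp_term P z w + (-2 * h) * inv_pow_term P 3 z w + (3 * h ^+ 2) * inv_pow_term P 4 z w)
    (wp_sum P z + -2 * inv_pow_sum P 3 z * h + 3 * inv_pow_sum P 4 z * h ^+ 2).
  have := box_cvgD (box_cvgD (wp_term_cvg g) (box_cvgZ (-2 * h) (inv_pow_term_cvg g (isT : (3 <= 3)%N))))
    (box_cvgZ (3 * h ^+ 2) (inv_pow_term_cvg g (isT : (3 <= 4)%N))).
  by rewrite (mulrAC (-2)) (mulrAC 3).
rewrite [leRHS]mulrAC; apply: (HK _ _ _ _ (box_cvgB H1 H2)) => w wL.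
have W := weight_gt0 w; rewrite /inv_pow_term /wp_term; case: ifP => Pw; last first.
  rewrite !mulr0 !addr0 subrr cabs0; apply: mulr_ge0; last exact: ltW.
  by rewrite !mulr_ge0 ?invr_ge0 ?exprn_ge0 // ltW.
have zw := gap_neq0 g wL Pw; have gz := gap_ge g wL Pw.
have hz : cabs h <= cabs (z + w) / 2 by lra.
have := inv2_jet zw hz; rewrite [z + w + h]addrAC => B.
rewrite (_ : _ - (_ + _ + _) = (z + h + w) ^- 2 - ((z + w) ^- 2 - 2 * h * (z + w) ^- 3 + 3 * h ^+ 2 * (z + w) ^- 4)); last by ring.
apply: le_trans B _.
rewrite (mulrAC 22 (d ^- 5)) -[leRHS]mulrA ler_wpM2l ?mulr_ge0 ?exprn_ge0 //.
exact: (gap_weight g).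
Qed.

Lemma inv_pow_sum_odd k : odd k -> (3 <= k)%N -> inv_pow_sum nonzero k 0 = 0.
Proof.
move=> ok k3; have [d g] := nonzero_gap0.
apply: (@box_cvg_odd _ w1 w2 (inv_pow_term nonzero k 0)); last exact: inv_pow_term_cvg g k3.
move=> w; rewrite /inv_pow_term /nonzero oppr_eq0; case: ifP => _; last by rewrite oppr0.
by rewrite !add0r -!exprVn invrN exprNn -signr_odd ok expr1 mulN1r.
Qed.

(** The order is dictated by the equation: [wp ^+ 3] multiplies this remainder by [z ^- 4], so
    [z ^ 5] is what leaves an error O(z). Odd powers drop out by [inv_pow_sum_odd]. *)
Lemma wp_sum_expansion : exists2 K : R, 0 < K & exists2 r : R, 0 < r & forall z, cabs z < r ->
  cabs (wp_sum nonzero z - (3 * inv_pow_sum nonzero 4 0 * z ^+ 2 + 5 * inv_pow_sum nonzero 6 0 * z ^+ 4)) <= K * cabs z ^+ 5.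
Proof.
have [d g] := nonzero_gap0; have [d0 _] := g; have [K K0 HK] := box_cvg_bound w2_neq0 w12.
exists (34 * d ^- 7 * K); first by rewrite !mulr_gt0 ?invr_gt0 ?exprn_gt0.
exists (d / 2) => [|z zd]; first lra.
have z0 := cabs_ge0 z.
have := wp_term_cvg (gap_near g zd); rewrite add0r => H1.
have tH k (k3 : (3 <= k)%N) := inv_pow_term_cvg g k3.
have H2 := box_cvgD (box_cvgD (box_cvgD (box_cvgZ (-2 * z) (tH 3%N isT)) (box_cvgZ (3 * z ^+ 2) (tH 4%N isT)))
   (box_cvgZ (-4 * z ^+ 3) (tH 5%N isT))) (box_cvgZ (5 * z ^+ 4) (tH 6%N isT)).
rewrite (@inv_pow_sum_odd 3%N) // (@inv_pow_sum_odd 5%N) // !mulr0 add0r addr0 in H2.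
rewrite (mulrAC 3) (mulrAC 5) [leRHS]mulrAC; apply: (HK _ _ _ _ (box_cvgB H1 H2)) => w wL.
have W := weight_gt0 w; rewrite /inv_pow_term /wp_term; case: ifP => Pw; last first.
  rewrite !mulr0 !addr0 subrr cabs0; apply: mulr_ge0; last exact: ltW.
  by rewrite !mulr_ge0 ?invr_ge0 ?exprn_ge0 // ltW.
have zw := gap_neq0 g wL Pw; have gz := gap_ge g wL Pw.
have hz : cabs z <= cabs (0 + w) / 2 by lra.
have := inv2_taylor zw hz; rewrite (addrC _ z) !add0r => B.
rewrite (_ : _ - _ = (z + w) ^- 2 - (w ^- 2 - 2 * z * w ^- 3 + 3 * z ^+ 2 * w ^- 4
     - 4 * z ^+ 3 * w ^- 5 + 5 * z ^+ 4 * w ^- 6)); last by ring.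
apply: le_trans B _.
rewrite (mulrAC 34 (d ^- 7)) -[leRHS]mulrA ler_wpM2l ?mulr_ge0 ?exprn_ge0 //.
by have := gap_weight (k := 7) g wL Pw isT; rewrite add0r.
Qed.

(** Likewise [dwp ^+ 2] multiplies this remainder by [z ^- 3], hence the order 4. *)
Lemma inv_pow_sum3_expansion : exists2 K : R, 0 < K & exists2 r : R, 0 < r & forall z, cabs z < r ->
  cabs (inv_pow_sum nonzero 3 z - (- 3 * inv_pow_sum nonzero 4 0 * z - 10 * inv_pow_sum nonzero 6 0 * z ^+ 3)) <= K * cabs z ^+ 4.
Proof.
have [d g] := nonzero_gap0; have [d0 _] := g; have [K K0 HK] := box_cvg_bound w2_neq0 w12.
exists (240 * d ^- 7 * K); first by rewrite !mulr_gt0 ?invr_gt0 ?exprn_gt0.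
exists (d / 2) => [|z zd]; first lra.
have z0 := cabs_ge0 z.
have := inv_pow_term_cvg (gap_near g zd) (leqnn 3); rewrite add0r => H1.
have tH k (k3 : (3 <= k)%N) := inv_pow_term_cvg g k3.
have H2 := box_cvgD (box_cvgD (box_cvgD (tH 3%N isT) (box_cvgZ (-3 * z) (tH 4%N isT)))
   (box_cvgZ (6 * z ^+ 2) (tH 5%N isT))) (box_cvgZ (-10 * z ^+ 3) (tH 6%N isT)).
rewrite (@inv_pow_sum_odd 3%N) // (@inv_pow_sum_odd 5%N) // !mulr0 add0r addr0 in H2.
rewrite (_ : - 3 * inv_pow_sum nonzero 4 0 * z - 10 * inv_pow_sum nonzero 6 0 * z ^+ 3 =
  - 3 * z * inv_pow_sum nonzero 4 0 + - 10 * z ^+ 3 * inv_pow_sum nonzero 6 0); last by ring.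
rewrite [leRHS]mulrAC; apply: (HK _ _ _ _ (box_cvgB H1 H2)) => w wL.
have W := weight_gt0 w; rewrite /inv_pow_term; case: ifP => Pw; last first.
  rewrite !mulr0 !addr0 subrr cabs0; apply: mulr_ge0; last exact: ltW.
  by rewrite !mulr_ge0 ?invr_ge0 ?exprn_ge0 // ltW.
have zw := gap_neq0 g wL Pw; have gz := gap_ge g wL Pw.
have hz : cabs z <= cabs (0 + w) / 2 by lra.
have := inv3_taylor zw hz; rewrite (addrC _ z) !add0r => B.
rewrite (_ : _ - _ = (z + w) ^- 3 - (w ^- 3 - 3 * z * w ^- 4 + 6 * z ^+ 2 * w ^- 5
     - 10 * z ^+ 3 * w ^- 6)); last by ring.
apply: le_trans B _.
rewrite (mulrAC 240 (d ^- 7)) -[leRHS]mulrA ler_wpM2l ?mulr_ge0 ?exprn_ge0 //.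
by have := gap_weight (k := 7) g wL Pw isT; rewrite add0r.
Qed.

Lemma gapT z : ~ L z -> exists d, gap predT z d.
Proof.
move=> zL; have [|d d0 H] := @lattice_gap _ w1 w2 w2_neq0 w12 predT z.
  move=> w wL _; apply/eqP => e; apply: zL.
  have -> : z = - w by apply/eqP; rewrite -addr_eq0 e.
  exact: latticeN.
by exists d.
Qed.

Lemma pow3_le_pow2 w : (1 + cabs w) ^- 3 <= (1 + cabs w) ^- 2.
Proof.
have w0 := cabs_ge0 w.
rewrite lef_pV2 ?posrE ?exprn_gt0 //; try lra.
by apply: ler_weXn2l => //; lra.
Qed.

Lemma not_lattice_shift z w : L w -> ~ L z -> ~ L (z + w).
Proof.
move=> wL zL zwL; apply: zL; rewrite -(addrK w z).
by apply: latticeD => //; exact: latticeN.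
Qed.

Lemma basis_lattice w : (w = w1 \/ w = w2) -> L w.
Proof.
move=> [->|->]; [exists 1, 0|exists 0, 1]; by rewrite mul1r mul0r ?addr0 ?add0r.
Qed.

(** The convergence terms [v ^- 2] cancel in the difference, which becomes [F (v + w) - F v] for
    [F v = (z + v) ^- 2], with exactly the quadratic decay that [box_cvg_telescope] asks for. *)
Lemma wp_sum_periodic z w : (w = w1 \/ w = w2) -> ~ L z -> wp_sum predT (z + w) = wp_sum predT z.
Proof.
move=> hw zL; have [d g] := gapT zL.
have [d' g'] := gapT (not_lattice_shift (basis_lattice hw) zL).
have H := box_cvgB (wp_term_cvg g') (wp_term_cvg g).
apply/eqP; rewrite -subr_eq0; apply/eqP; apply: box_cvg_unique H _.
have [|T1 T2] := @box_cvg_telescope _ w1 w2 w2_neq0 w12 (fun v => (z + v) ^- 2) (d ^- 2).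
  by move=> v vL; rewrite cabsV cabsX; apply: gap_pow g vL isT.
by case: hw => ->; [apply: box_cvg_ext T1|apply: box_cvg_ext T2] => v _;
  rewrite /wp_term /= addrA addrAC; ring.
Qed.

Lemma inv_pow_sum3_periodic z w : (w = w1 \/ w = w2) -> ~ L z -> inv_pow_sum predT 3 (z + w) = inv_pow_sum predT 3 z.
Proof.
move=> hw zL; have [d g] := gapT zL.
have [d' g'] := gapT (not_lattice_shift (basis_lattice hw) zL).
have H := box_cvgB (inv_pow_term_cvg g' (leqnn 3)) (inv_pow_term_cvg g (leqnn 3)).
apply/eqP; rewrite -subr_eq0; apply/eqP; apply: box_cvg_unique H _.
have [|T1 T2] := @box_cvg_telescope _ w1 w2 w2_neq0 w12 (fun v => (z + v) ^- 3) (d ^- 3).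
  move=> v vL; rewrite cabsV cabsX; apply: le_trans (gap_pow 3 g vL isT) _.
  by rewrite ler_wpM2l ?pow3_le_pow2 // invr_ge0 exprn_ge0 // ltW //; case: g.
by case: hw => ->; [apply: box_cvg_ext T1|apply: box_cvg_ext T2] => v _;
  rewrite /inv_pow_term /= addrA addrAC.
Qed.

End LatticeFunctions.

(** * A maximum principle *)

Section MaximumPrinciple.
Variable R : realType.
Local Notation C := (Cplx R).
Implicit Types (f g : C -> C) (z h : C).

Definition cont_at f z := forall e : R, 0 < e ->
  exists2 r : R, 0 < r & forall y, cabs (y - z) < r -> cabs (f y - f z) < e.

Lemma cont_at_ext f g z : f =1 g -> cont_at f z -> cont_at g z.
Proof.
move=> fg h e /h[r r0 H]; exists r => // y /H.
by rewrite !fg.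
Qed.

Lemma cont_atM f g z : cont_at f z -> cont_at g z -> cont_at (fun y => f y * g y) z.
Proof.
move=> hf hg e e0; have f0 := cabs_ge0 (f z); have g0 := cabs_ge0 (g z).
pose M := cabs (f z) + cabs (g z) + 1.
have M0 : 0 < M by rewrite /M; lra.
pose d := Num.min 1 (e / M).
have d0 : 0 < d by rewrite lt_min ltr01 divr_gt0.
have d1 : d <= 1 by rewrite ge_min lexx.
have dM : d * M <= e by rewrite -ler_pdivlMr // ge_min lexx orbT.
have [r r0 Hf] := hf _ d0; have [s s0 Hg] := hg _ d0.
exists (Num.min r s) => [|y]; first by rewrite lt_min r0.
rewrite lt_min => /andP[/Hf h1 /Hg h2]; apply: lt_le_trans dM.
set A := f y - f z in h1; set B := g y - g z in h2.
have -> : f y * g y - f z * g z = A * g z + (f z * B + A * B) by rewrite /A /B; ring.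
have a0 := cabs_ge0 A; have b0 := cabs_ge0 B.
apply: le_lt_trans (cabsD _ _) _; rewrite cabsM.
have := cabsD (f z * B) (A * B); rewrite !cabsM /M; nra.
Qed.

(** Discrete Parseval: over the four values [h = i ^ k t] the monomials 1, [h], [h ^ 2] are
    orthogonal, so all cross terms cancel. *)
Lemma sum4_sqr_cabs (a b c i : C) (t : R) : i = Complex 0 1 ->
  cabs (a + b * rc t + c * rc t ^+ 2) ^+ 2 + cabs (a + b * (- rc t) + c * (- rc t) ^+ 2) ^+ 2 +
  cabs (a + b * (i * rc t) + c * (i * rc t) ^+ 2) ^+ 2 +
  cabs (a + b * (- (i * rc t)) + c * (- (i * rc t)) ^+ 2) ^+ 2 =
  4 * cabs a ^+ 2 + 4 * cabs b ^+ 2 * t ^+ 2 + 4 * cabs c ^+ 2 * t ^+ 4.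
Proof.
move=> ->; rewrite !sqr_cabs !sqrrN (expr2 (rc t : C)) (expr2 (_ * rc t : C)) /rc.
by move: a b c => [a a'] [b b'] [c c'] /=; ring.
Qed.

(* The mean of [|g| ^ 2] over the four points [z + i ^ k t] exceeds
   [|g z| ^ 2 + |g' z| ^ 2 t ^ 2] up to O(t ^ 3), so that [e |z| ^ 2] makes it strictly
   larger than the central value. *)
Lemma no_interior_max g z (e r : R) : has_jet2 g z -> 0 < e -> 0 < r ->
  ~ (forall h, cabs h < r ->
       cabs (g (z + h)) ^+ 2 + e * cabs (z + h) ^+ 2 <= cabs (g z) ^+ 2 + e * cabs z ^+ 2).
Proof.
move=> [a [b [c hj]]] e0 r0 H; have gz := jet2_val hj.
move: hj => [K [s [K0 s0 J]]].
have a0 := cabs_ge0 a; have b0 := cabs_ge0 b; have c0 := cabs_ge0 c.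
pose A := cabs a + cabs b + cabs c; have A0 : 0 <= A by rewrite /A; lra.
have B0 : 0 < 2 * A * K + 1 by have := mulr_ge0 A0 K0; lra.
(* Below [e / (2 A K + 1)] the error [2 A K t ^ 3] is smaller than the gain [e t ^ 2]; the halving
   makes all bounds strict. *)
pose t := Num.min (Num.min 1 (e / (2 * A * K + 1))) (Num.min r s) / 2.
have [t0 t1 te tr ts] : [/\ 0 < t, t < 1, t < e / (2 * A * K + 1), t < r & t < s].
  have eB : 0 < e / (2 * A * K + 1) by rewrite divr_gt0.
  have m0 : 0 < Num.min (Num.min 1 (e / (2 * A * K + 1))) (Num.min r s).
    by rewrite !lt_min ltr01 eB r0 s0.
  have h1 : Num.min (Num.min 1 (e / (2 * A * K + 1))) (Num.min r s) <= 1 by rewrite !ge_min lexx.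
  have h2 : Num.min (Num.min 1 (e / (2 * A * K + 1))) (Num.min r s) <= e / (2 * A * K + 1) by rewrite !ge_min lexx orbT.
  have h3 : Num.min (Num.min 1 (e / (2 * A * K + 1))) (Num.min r s) <= r by rewrite !ge_min lexx !orbT.
  have h4 : Num.min (Num.min 1 (e / (2 * A * K + 1))) (Num.min r s) <= s by rewrite !ge_min lexx !orbT.
  by rewrite /t; move: m0 h1 h2 h3 h4; move: (Num.min _ _) => m *; split; lra.
have key h : cabs h = t -> cabs (a + b * h + c * h ^+ 2) ^+ 2 + e * cabs (z + h) ^+ 2 <=
    cabs a ^+ 2 + e * cabs z ^+ 2 + 2 * A * K * t ^+ 3.
  move=> ht; have := H h; have := J h; rewrite gz ht => /(_ ts) hJ /(_ tr) hH.
  set T := a + _ + _ in hJ *.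
  have TA : cabs T <= A.
    apply: le_trans (cabsD _ _) _; rewrite !cabsM ?cabsX ht.
    have := cabsD a (b * h); rewrite cabsM ht /A.
    have : t ^+ 2 <= 1 by rewrite expr_le1 // ltW.
    nra.
  have hT : cabs T - K * t ^+ 3 <= cabs (g (z + h)).
    have := cabsB (g (z + h)) (g (z + h) - T); rewrite opprB addrC subrK; lra.
  have -> : 2 * A * K * t ^+ 3 = 2 * A * (K * t ^+ 3) by ring.
  have T0 := cabs_ge0 T; have G0 := cabs_ge0 (g (z + h)).
  have : 0 <= K * t ^+ 3 by rewrite mulr_ge0 // exprn_ge0 // ltW.
  move: (K * t ^+ 3) hT hJ => E hT hJ E0.
  suff : cabs T ^+ 2 - 2 * A * E <= cabs (g (z + h)) ^+ 2.
    lra.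
  (* If [|T| <= E] the left side is not positive; otherwise [(|T| - E) ^ 2 <= |g (z + h)| ^ 2] and
     [|T| <= A]. *)
  have [le|lt] := leP (cabs T) E; nra.
pose i : C := Complex 0 1.
have ci : cabs i = 1 by rewrite /cabs /i /= expr0n add0r expr1n sqrtr1.
have ct : cabs (rc t) = t by rewrite cabs_rc ger0_norm // ltW.
have k1 := key (rc t) ct; have := key (- rc t); rewrite cabsN => /(_ ct) k2.
have cit : cabs (i * rc t) = t by rewrite cabsM ci mul1r.
have k3 := key _ cit; have := key (- (i * rc t)); rewrite cabsN => /(_ cit) k4.
(* The second instance, for the polynomial [z + h], gives [4 |z| ^ 2 + 4 t ^ 2]: this is the gain
   from the term in [e]. *)
have S1 := sum4_sqr_cabs a b c t (erefl i); have S2 := sum4_sqr_cabs z 1 0 t (erefl i).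
rewrite cabs1 cabs0 !mul0r !mul1r !addr0 in S2.
have P1 : 0 <= cabs b ^+ 2 * t ^+ 2 by rewrite mulr_ge0 ?exprn_ge0 // ltW.
have P2 : 0 <= cabs c ^+ 2 * t ^+ 4 by rewrite mulr_ge0 ?exprn_ge0 // ltW.
have : e * t ^+ 2 <= 2 * A * K * t ^+ 3.
  move: k1 k2 k3 k4 S1 S2.
  set x1 := cabs (a + _ + _) ^+ 2; set x2 := cabs (a + _ + _) ^+ 2.
  set x3 := cabs (a + _ + _) ^+ 2; set x4 := cabs (a + _ + _) ^+ 2.
  set y1 := cabs (z + _) ^+ 2; set y2 := cabs (z + _) ^+ 2.
  set y3 := cabs (z + _) ^+ 2; set y4 := cabs (z + _) ^+ 2.
  move=> k1 k2 k3 k4 S1 S2.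
  have : e * (y1 + y2 + y3 + y4) = e * (4 * cabs z ^+ 2 + 4 * (1 ^+ 2) * t ^+ 2 + 4 * 0 ^+ 2 * t ^+ 4).
    by rewrite S2.
  rewrite expr1n expr0n /= !mulr0 !mul0r !addr0 mulr1; lra.
have t20 : 0 < t ^+ 2 by rewrite exprn_gt0.
rewrite (exprSr t 2) (mulrCA _ (t ^+ 2)) (mulrC (t ^+ 2)) ler_pM2r //.
by move: te; rewrite ltr_pdivlMr // => te h; lra.
Qed.

(** Compactness is that of the square of real coordinates. The case [e = 0] also serves, to bound
    [defect]. *)
Lemma parallelogram_max (w1 w2 : C) g (e N : R) : 0 <= N -> (forall z, cont_at g z) ->
  exists s0 t0 : R, [/\ `|s0| <= N, `|t0| <= N & forall s t : R, `|s| <= N -> `|t| <= N ->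
    cabs (g (rc s * w1 + rc t * w2)) ^+ 2 + e * cabs (rc s * w1 + rc t * w2) ^+ 2 <=
    cabs (g (rc s0 * w1 + rc t0 * w2)) ^+ 2 + e * cabs (rc s0 * w1 + rc t0 * w2) ^+ 2].
Proof.
move=> N0 gc; pose lin (p : R * R) : C := rc p.1 * w1 + rc p.2 * w2.
have W1 := cabs_ge0 w1; have W2 := cabs_ge0 w2.
have cont (k : C -> C) : (forall z, cont_at k z) -> continuous (fun p : R * R => cabs (k (lin p))).
  move=> kc p; apply/cvgrPdist_lt => d d0.
  have [r r0 Hr] := kc (lin p) d d0.
  have rD : 0 < r / (cabs w1 + cabs w2 + 1) by rewrite divr_gt0 //; lra.
  apply: filterS (nbhsx_ballx p _ rD) => q [/= q1 q2].
  have lt : cabs (lin q - lin p) < r.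
    have -> : lin q - lin p = rc (q.1 - p.1) * w1 + rc (q.2 - p.2) * w2.
      by rewrite /lin /rc !rmorphB /=; ring.
    move: q1 q2; rewrite /ball /= !(distrC (p.1)) !(distrC p.2).
    rewrite !ltr_pdivlMr; [|lra|lra] => q1 q2.
    apply: le_lt_trans (cabsD _ _) _; rewrite !cabs_rcM.
    have := normr_ge0 (q.1 - p.1); have := normr_ge0 (q.2 - p.2).
    move: (`|_|) (`|_|) q1 q2 => u v; nra.
  have := Hr _ lt; rewrite ltr_norml => h.
  have := cabsD (k (lin q) - k (lin p)) (k (lin p)); rewrite subrK.
  have := cabsD (k (lin p) - k (lin q)) (k (lin q)); rewrite subrK.
  rewrite (cabs_distrC (k (lin p))); lra.
have idc z : cont_at id z by move=> d d0; exists d.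
pose phi (p : R * R) := cabs (g (lin p)) ^+ 2 + e * cabs (lin p) ^+ 2.
have phic : continuous phi.
  move=> p; have h1 := cont _ gc p; have h2 := cont _ idc p.
  apply: cvgD; first exact: (cvgM h1 h1).
  by apply: cvgM; [exact: cvg_cst|exact: (cvgM h2 h2)].
pose I : set R := `[- N, N]%classic.
have cI : compact (I `*` I) by apply: compact_setX; exact: segment_compact.
have nI : (I `*` I) !=set0 by exists (0, 0); split; rewrite /I /= in_itv /=; apply/andP; split; lra.
have [|[s0 t0]] := @compact_EVT_max _ R phi _ nI cI.
  by apply: continuous_subspaceT => p; exact: phic.
rewrite inE => -[/= hs ht] H; exists s0, t0; split.
- by move: hs; rewrite /I /= in_itv /= ler_norml.
- by move: ht; rewrite /I /= in_itv /= ler_norml.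
move=> s t hs' ht'; have := H (s, t); rewrite inE; apply.
by split; rewrite /I /= in_itv /= -ler_norml.
Qed.

End MaximumPrinciple.

(** * The differential equation *)

Section BoundedNearZero.
Variable R : realType.
Local Notation C := (Cplx R).
Implicit Types (f g : C -> C) (z : C).

(** A calculus of O(1) on punctured discs, where dividing by powers of [z] is harmless; it reduces
    [defect_near0] to algebra. *)
Definition bounded_near0 f := exists K r : R, [/\ 0 <= K, 0 < r &
  forall z, z != 0 -> cabs z < r -> cabs (f z) <= K].

Lemma bounded_near0_cst c : bounded_near0 (fun=> c).
Proof. by exists (cabs c), 1; split => //; exact: cabs_ge0. Qed.

Lemma bounded_near0_id : bounded_near0 id.
Proof. by exists 1, 1; split => // z _ /ltW. Qed.

Lemma bounded_near0D f g : bounded_near0 f -> bounded_near0 g ->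
  bounded_near0 (fun z => f z + g z).
Proof.
move=> [K [r [K0 r0 H]]] [K' [r' [K0' r0' H']]]; exists (K + K'), (Num.min r r').
split; [lra|by rewrite lt_min r0|move=> z z0; rewrite lt_min => /andP[/(H _ z0) h /(H' _ z0) h']].
by apply: le_trans (cabsD _ _) _; lra.
Qed.

Lemma bounded_near0M f g : bounded_near0 f -> bounded_near0 g ->
  bounded_near0 (fun z => f z * g z).
Proof.
move=> [K [r [K0 r0 H]]] [K' [r' [K0' r0' H']]]; exists (K * K'), (Num.min r r').
split; [by rewrite mulr_ge0|by rewrite lt_min r0|].
move=> z z0; rewrite lt_min => /andP[/(H _ z0) h /(H' _ z0) h'].
by rewrite cabsM ler_pM // cabs_ge0.
Qed.

Lemma bounded_near0X f n : bounded_near0 f -> bounded_near0 (fun z => f z ^+ n).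
Proof.
move=> h; elim: n => [|n IH]; first exact: bounded_near0_cst.
have [K [r [K0 r0 H]]] := bounded_near0M h IH; exists K, r; split => // z z0 zr.
by rewrite exprS; exact: H.
Qed.

Lemma bounded_near0_div f (K r : R) n : 0 < r ->
  (forall z, cabs z < r -> cabs (f z) <= K * cabs z ^+ n) -> bounded_near0 (fun z => f z / z ^+ n).
Proof.
move=> r0 H; exists `|K|, r; split => // z z0 /H h.
have c0 : 0 < cabs z by rewrite cabs_gt0.
rewrite cabsM cabsV cabsX ler_pdivrMr ?exprn_gt0 //; apply: le_trans h _.
by rewrite ler_wpM2r ?exprn_ge0 ?ler_norm // ltW.
Qed.

End BoundedNearZero.

(** * Periodicity, meromorphy and the vanishing of the defect *)

Section Weierstrass.
Variables (R : realType) (w1 w2 : Cplx R).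
Hypothesis (w2_neq0 : w2 != 0) (w12 : w1 / w2 \isn't Num.real).
Local Notation C := (Cplx R).
Local Notation L := (lattice w1 w2).
Local Notation wp := (wp w1 w2).
Local Notation dwp := (dwp w1 w2).
Local Notation inv_pow_sum := (inv_pow_sum w1 w2).
Local Notation wp_sum := (wp_sum w1 w2).
Local Notation gap := (gap w1 w2).
Local Notation E4 := (eisenstein w1 w2 4).
Local Notation E6 := (eisenstein w1 w2 6).
Local Notation nonzero := (@nonzero R).
Implicit Types (z h w : C).

Lemma gapT_notin z d : gap predT z d -> ~ L z.
Proof.
move=> g zL; have := gap_neq0 g (latticeN zL) isT.
by rewrite subrr eqxx.
Qed.

Lemma gap_nonzero_notin d z : gap nonzero 0 d -> z != 0 -> cabs z < d -> ~ L z.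
Proof. by move=> g z0 zd zL; have := gap_ge g zL z0; rewrite add0r; lra. Qed.

Lemma wp_has_jet2 z : ~ L z -> has_jet2 wp z.
Proof.
move=> /(gapT w2_neq0 w12)[d g]; have := wp_sum_jet w2_neq0 w12 g => h.
apply: (has_jet2_ext (fun y => esym (wpE w1 w2 y))).
by do 3 eexists; exact: h.
Qed.

Lemma dwpE z : ~ L z -> dwp z = - 2 * inv_pow_sum predT 3 z.
Proof.
move=> /(gapT w2_neq0 w12)[d g]; have := wp_sum_jet w2_neq0 w12 g => h.
apply: jet2_derive1; apply: jet2_ext h => y; exact/esym/wpE.
Qed.

Lemma dwp_has_jet2 z : ~ L z -> has_jet2 dwp z.
Proof.
move=> zL; have [d g] := gapT w2_neq0 w12 zL; have [d0 _] := g.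
have h := inv_pow_sum3_jet w2_neq0 w12 g.
apply: (@has_jet2_near _ (fun y => - 2 * inv_pow_sum predT 3 y) _ _ (d / 2)); first lra.
  by move=> k hk; rewrite dwpE //; exact: gapT_notin (gap_near g hk).
by apply: has_jet2M; [exact: has_jet2_cst|do 3 eexists; exact: h].
Qed.

(** Induction on the coefficients; all intermediate points stay off the lattice by
    [not_lattice_shift]. *)
Lemma periodic_lattice (T : Type) (Q : C -> T) :
  (forall z w, (w = w1 \/ w = w2) -> ~ L z -> Q (z + w) = Q z) ->
  forall z w, L w -> ~ L z -> Q (z + w) = Q z.
Proof.
move=> H.
have nat_mul w : w = w1 \/ w = w2 -> forall (n : nat) z, ~ L z -> Q (z + n%:R * w) = Q z.
  move=> hw; elim=> [|n IH] z zL; first by rewrite mul0r addr0.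
  rewrite -natr1 mulrDl mul1r addrA H ?IH //; apply: not_lattice_shift => //.
  by case: hw => ->; [exists n, 0|exists 0, n]; rewrite mul0r ?addr0 ?add0r pmulrn.
have int_mul w : w = w1 \/ w = w2 -> forall (n : int) z, ~ L z -> Q (z + n%:~R * w) = Q z.
  move=> hw [n|n] z zL; first exact: (nat_mul _ hw n).
  (* Negative multiples follow by adding the positive multiple back. *)
  have e : z = z + (Negz n)%:~R * w + n.+1%:R * w.
    by rewrite NegzE mulrNz mulNr subrK.
  rewrite [in RHS]e nat_mul //; apply: not_lattice_shift => //.
  by case: hw => ->; [exists (Negz n), 0|exists 0, (Negz n)]; rewrite mul0r ?addr0 ?add0r.
move=> z w [m [n ->]] zL; rewrite addrA int_mul; [|by right|]; last first.
  by apply: not_lattice_shift => //; exists m, 0; rewrite mul0r addr0.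
by rewrite int_mul //; left.
Qed.

Lemma wp_periodic z w : L w -> ~ L z -> wp (z + w) = wp z.
Proof.
apply: periodic_lattice => {}z {}w hw zL; rewrite !wpE; exact: wp_sum_periodic.
Qed.

Lemma inv_pow_sum3_lattice_periodic z w : L w -> ~ L z -> inv_pow_sum predT 3 (z + w) = inv_pow_sum predT 3 z.
Proof. by apply: periodic_lattice => {}z {}w hw zL; exact: inv_pow_sum3_periodic. Qed.

Lemma dwp_periodic z w : L w -> ~ L z -> dwp (z + w) = dwp z.
Proof.
by move=> wL zL; rewrite !dwpE ?inv_pow_sum3_lattice_periodic //; exact: not_lattice_shift.
Qed.

Lemma wp_meromorphic : meromorphic_with_poles_in L wp.
Proof.
split=> z zL.
  have [d g] := gapT w2_neq0 w12 zL; have [d0 _] := g.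
  apply: (@has_jet2_holomorphic _ _ _ (d / 2)) => [|y hy]; first lra.
  apply: wp_has_jet2; have := gapT_notin (gap_near g hy).
  by rewrite addrC subrK.
have [d g] := nonzero_gap0 w2_neq0 w12; have [d0 _] := g.
(* This is [(y - z) ^ 2 wp y] with the pole translated to 0: beside the term [(y - z) ^- 2] the
   series is regular there. *)
exists 2%N, (fun y => 1 + (y - z) ^+ 2 * wp_sum nonzero (y - z)); split.
  apply: (@has_jet2_holomorphic _ _ _ (d / 2)) => [|y hy]; first lra.
  apply: has_jet2D; first exact: has_jet2_cst.
  apply: (@has_jet2_shift _ (fun u => u ^+ 2 * wp_sum nonzero u)).
  apply: has_jet2M; first exact/has_jet2X/has_jet2_id.
  have := gap_near g hy; rewrite add0r => g'.
  by do 3 eexists; exact: wp_sum_jet g'.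
apply/dnear_cabsP; exists d => // y yz hy.
have y0 : y - z != 0 by rewrite subr_eq0.
have yL := gap_nonzero_notin g y0 hy.
rewrite -{1}(subrK z y) wp_periodic // wpE wp_sum_split.
by field; rewrite y0.
Qed.

Lemma dwp_meromorphic : meromorphic_with_poles_in L dwp.
Proof.
split=> z zL.
  have [d g] := gapT w2_neq0 w12 zL; have [d0 _] := g.
  apply: (@has_jet2_holomorphic _ _ _ (d / 2)) => [|y hy]; first lra.
  apply: dwp_has_jet2; have := gapT_notin (gap_near g hy).
  by rewrite addrC subrK.
have [d g] := nonzero_gap0 w2_neq0 w12; have [d0 _] := g.
exists 3%N, (fun y => - 2 + - 2 * ((y - z) ^+ 3 * inv_pow_sum nonzero 3 (y - z))); split.
  apply: (@has_jet2_holomorphic _ _ _ (d / 2)) => [|y hy]; first lra.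
  apply: has_jet2D; first exact: has_jet2_cst.
  apply: has_jet2M; first exact: has_jet2_cst.
  apply: (@has_jet2_shift _ (fun u => u ^+ 3 * inv_pow_sum nonzero 3 u)).
  apply: has_jet2M; first exact/has_jet2X/has_jet2_id.
  have := gap_near g hy; rewrite add0r => g'.
  by do 3 eexists; exact: inv_pow_sum3_jet g'.
apply/dnear_cabsP; exists d => // y yz hy.
have y0 : y - z != 0 by rewrite subr_eq0.
have yL := gap_nonzero_notin g y0 hy.
rewrite -{1}(subrK z y) dwp_periodic // dwpE // inv_pow_sum_split.
by field; rewrite y0.
Qed.

Definition defect z : C := if z \in L then 0 else
  dwp z ^+ 2 - 4 * wp z ^+ 3 + 60 * E4 * wp z + 140 * E6.

Lemma defect_in z : L z -> defect z = 0.
Proof. by move=> zL; rewrite /defect mem_set. Qed.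

Lemma defect_notin z : ~ L z ->
  defect z = dwp z ^+ 2 - 4 * wp z ^+ 3 + 60 * E4 * wp z + 140 * E6.
Proof. by move=> zL; rewrite /defect memNset. Qed.

Lemma defect_periodic z w : L w -> defect (z + w) = defect z.
Proof.
move=> wL; have [zL|zL] := pselect (L z).
  by rewrite !defect_in //; exact: latticeD.
have zwL := not_lattice_shift wL zL.
by rewrite (defect_notin zL) (defect_notin zwL) (wp_periodic wL zL) (dwp_periodic wL zL).
Qed.

Lemma defect_has_jet2 z : ~ L z -> has_jet2 defect z.
Proof.
move=> zL; have [d g] := gapT w2_neq0 w12 zL; have [d0 _] := g.
apply: (@has_jet2_near _ (fun y => dwp y ^+ 2 + - 4 * wp y ^+ 3 + 60 * E4 * wp y + 140 * E6) _ _ (d / 2)).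
- lra.
- move=> h hd; rewrite defect_notin; last exact: gapT_notin (gap_near g hd).
  by rewrite mulNr.
have W := wp_has_jet2 zL; have D := dwp_has_jet2 zL.
have k c := @has_jet2_cst R c z.
do !apply: has_jet2D => //; do ?[apply: has_jet2M => //]; exact: has_jet2X.
Qed.

Lemma defect_near0 : exists K r : R, [/\ 0 <= K, 0 < r &
  forall z, cabs z < r -> cabs (defect z) <= K * cabs z].
Proof.
have [K1 _ [r1 r10 H1]] := wp_sum_expansion w2_neq0 w12.
have [K2 _ [r2 r20 H2]] := inv_pow_sum3_expansion w2_neq0 w12.
have [d g] := nonzero_gap0 w2_neq0 w12; have [d0 _] := g.
have Bp := bounded_near0_div r10 H1; have Bq := bounded_near0_div r20 H2.
rewrite -!eisensteinE in Bp Bq.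
set p := fun z => _ in Bp; set q := fun z => _ in Bq.
(* Off 0, [wp z = z ^- 2 + z ^ 2 g2 z] and [dwp z = - 2 z ^- 3 + z g1 z]. *)
pose g1 z := 6 * E4 + 20 * E6 * z ^+ 2 + - 2 * (z ^+ 3 * q z).
pose g2 z := 3 * E4 + 5 * E6 * z ^+ 2 + z ^+ 3 * p z.
(* The quotient [defect z / z]. The polar parts cancel because [4 g1 + 12 g2] is
   [60 E4 + 140 E6 z ^ 2] up to O(z ^ 3), with 60 = 24 + 36 and 140 = 80 + 60: the origin of the
   coefficients of the equation. *)
pose S z := - 12 * p z + 8 * q z + z * g1 z ^+ 2 + - 12 * (z * g2 z ^+ 2) +
  - 4 * (z ^+ 5 * g2 z ^+ 3) + 60 * E4 * (z * g2 z).
have cst := @bounded_near0_cst R; have idb := bounded_near0_id R.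
have B1 : bounded_near0 g1.
  by do !apply: bounded_near0D; do !apply: bounded_near0M => //; exact: bounded_near0X.
have B2 : bounded_near0 g2.
  by do !apply: bounded_near0D; do !apply: bounded_near0M => //; exact: bounded_near0X.
have BS : bounded_near0 S.
  by do !apply: bounded_near0D; do !apply: bounded_near0M => //; exact: bounded_near0X.
have [K [r [K0 r0 H]]] := BS.
exists K, (Num.min r d); split => // [|z]; first by rewrite lt_min r0.
rewrite lt_min => /andP[zr zd].
have [->|z0] := eqVneq z 0.
  by rewrite defect_in ?cabs0 ?mulr0 //; exact: lattice0.
have zL := gap_nonzero_notin g z0 zd.
suff -> : defect z = S z * z by rewrite cabsM ler_wpM2r ?cabs_ge0 // H.
rewrite defect_notin // dwpE // wpE wp_sum_split inv_pow_sum_split.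
have e1 : wp_sum nonzero z = 3 * E4 * z ^+ 2 + 5 * E6 * z ^+ 4 + z ^+ 5 * p z.
  by rewrite /p; field; rewrite z0.
have e2 : inv_pow_sum nonzero 3 z = - 3 * E4 * z - 10 * E6 * z ^+ 3 + z ^+ 4 * q z.
  by rewrite /q; field; rewrite z0.
rewrite e1 e2 /S /g1 /g2; move: (p z) (q z) E4 E6 => {e1 e2}p' q' e4 e6.
by field; rewrite z0.
Qed.

Lemma defect_cont z : cont_at defect z.
Proof.
have [zL|zL] := pselect (L z); last exact: has_jet2_cont (defect_has_jet2 zL).
have [K [r [K0 r0 H]]] := defect_near0 => e e0.
exists (Num.min r (e / (K + 1))) => [|y]; first by rewrite lt_min r0 divr_gt0 //; lra.
rewrite lt_min => /andP[/H h]; rewrite ltr_pdivlMr; last lra.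
rewrite (defect_in zL) subr0 -{2}(subrK z y) defect_periodic // => h2.
by have := cabs_ge0 (y - z); lra.
Qed.

(** At 0 the convention [0^-1 = 0] gives the limit value, since [defect z ^+ 2] is O(z ^ 2). *)
Definition quotient z : C := defect z ^+ 2 / z.

Lemma quotient_cont z : cont_at quotient z.
Proof.
have [->|z0] := eqVneq z 0.
  have [K [r [K0 r0 H]]] := defect_near0 => e e0.
  have K20 : 0 < K ^+ 2 + 1 by have := sqr_ge0 K; lra.
  exists (Num.min r (e / (K ^+ 2 + 1))) => [|y]; first by rewrite lt_min r0 divr_gt0.
  rewrite subr0 lt_min => /andP[/H h]; rewrite ltr_pdivlMr // => h2.
  rewrite /quotient invr0 mulr0 subr0.
  have [->|y0] := eqVneq y 0; first by rewrite invr0 mulr0 cabs0.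
  have c0 : 0 < cabs y by rewrite cabs_gt0.
  rewrite cabsM cabsV cabsX ltr_pdivrMr //.
  have : cabs (defect y) ^+ 2 <= (K * cabs y) ^+ 2 by apply: lerXn2r; rewrite ?nnegrE ?cabs_ge0 ?mulr_ge0 // ltW.
  rewrite exprMn => h3; apply: le_lt_trans h3 _.
  by rewrite [X in _ * X]expr2 mulrA ltr_pM2r //; lra.
have D : cont_at defect z by exact: defect_cont.
apply: cont_atM; last exact: has_jet2_cont (has_jet2V z0).
by apply: cont_at_ext (cont_atM D D) => y; rewrite expr2.
Qed.

Lemma quotient_has_jet2 z : ~ L z -> has_jet2 quotient z.
Proof.
move=> zL; have z0 : z != 0 by apply/eqP => e; apply: zL; rewrite e; exact: lattice0.
by apply: has_jet2M; [exact/has_jet2X/defect_has_jet2|exact: has_jet2V].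
Qed.

Lemma reduce_mod_lattice z : exists s t w,
  [/\ `|s| <= 1, `|t| <= 1, L w & z = rc s * w1 + rc t * w2 + w].
Proof.
have [s [t ->]] := basis_coord w2_neq0 w12 z.
have fl (x : R) : exists (y : R) (n : int), `|y| <= 1 /\ x = y + n%:~R.
  exists (x - (Num.floor x)%:~R), (Num.floor x); split; last by rewrite subrK.
  have /andP[h1 h2] := floor_itv x.
  by move: h2; rewrite intrD ger0_norm; lra.
have [a [m [ha ->]]] := fl s; have [b [n [hb ->]]] := fl t.
exists a, b, (m%:~R * w1 + n%:~R * w2); split => //; first by exists m, n.
by rewrite /rc !rmorphD /= !rmorph_int; ring.
Qed.

Lemma defect_bounded : exists2 M : R, 0 <= M & forall z, cabs (defect z) <= M.
Proof.
(* With [e = 0] the maximised function is [|defect| ^ 2]; [N = 1] covers representatives of all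
   points modulo the lattice. *)
have [s0 [t0 [_ _]]] := @parallelogram_max R w1 w2 defect 0 1 ler01 defect_cont.
move: (rc s0 * w1 + rc t0 * w2) => z0 H.
exists (cabs (defect z0)) => [|z]; first exact: cabs_ge0.
have [s [t [w [hs ht wL ->]]]] := reduce_mod_lattice z.
have := H s t hs ht; rewrite !(mul0r (cabs _ ^+ 2)) !addr0 (defect_periodic _ wL).
by rewrite ler_pXn2r ?nnegrE ?cabs_ge0.
Qed.

Lemma defect_eq0 z : defect z = 0.
Proof.
have [M M0 HM] := defect_bounded.
have [c /andP[c0 _] Hc] := basis_bound w2_neq0 w12.
have [s [t zE]] := basis_coord w2_neq0 w12 z.
pose D := cabs w1 + cabs w2.
have W1 := cabs_ge0 w1; have W2 := cabs_ge0 w2.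
(* The value at the maximum point [z1] bounds the one at [z]; [e (N D) ^ 2] is the price of the
   perturbation. *)
have main (N e : R) : 0 < N -> `|s| <= N -> `|t| <= N -> 0 < e ->
    cabs (quotient z) ^+ 2 <= (M ^+ 2 / (c * N)) ^+ 2 + e * (N * D) ^+ 2.
  move=> N0 hs ht e0.
  have [s0 [t0 [hs0 ht0 H]]] := @parallelogram_max R w1 w2 quotient e N (ltW N0) quotient_cont.
  have := H s t hs ht; rewrite -zE; set z1 := rc s0 * w1 + rc t0 * w2 in H *.
  have z1D : cabs z1 <= N * D.
    apply: le_trans (cabsD _ _) _; rewrite !cabs_rcM /D mulrDr.
    by apply: lerD; rewrite ler_wpM2r.
  have ez : e * cabs z1 ^+ 2 <= e * (N * D) ^+ 2.
    rewrite ler_pM2l //; apply: lerXn2r; rewrite ?nnegrE ?cabs_ge0 //.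
    by apply: mulr_ge0; [exact: ltW | rewrite /D; lra].
  suff : cabs (quotient z1) ^+ 2 <= (M ^+ 2 / (c * N)) ^+ 2.
    have : 0 <= e * cabs z ^+ 2 by rewrite mulr_ge0 ?exprn_ge0 ?cabs_ge0 // ltW.
    lra.
  have B0 : 0 <= M ^+ 2 / (c * N) by rewrite divr_ge0 ?exprn_ge0 ?mulr_ge0 // ltW.
  apply: lerXn2r; rewrite ?nnegrE ?cabs_ge0 //.
  have [z1L|z1L] := pselect (L z1).
    by rewrite /quotient (defect_in z1L) expr0n mul0r cabs0.
  have bd : c * N <= cabs z1 -> cabs (quotient z1) <= M ^+ 2 / (c * N).
    have cN : 0 < c * N by rewrite mulr_gt0.
    move=> h; rewrite /quotient cabsM cabsV cabsX.
    apply: ler_pM; rewrite ?invr_ge0 ?exprn_ge0 ?cabs_ge0 //.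
      by apply: lerXn2r; rewrite ?nnegrE ?cabs_ge0 // HM.
    by rewrite lef_pV2 // posrE //; apply: lt_le_trans h.
  (* On the boundary one coordinate has size [N], hence [|z1| >= c N]. *)
  have bnd := Hc s0 t0; rewrite -/z1 in bnd.
  have [sN|sN] := eqVneq `|s0| N.
    apply: bd; apply: le_trans bnd; rewrite ler_pM2l // sN.
    by have := normr_ge0 t0; lra.
  have [tN|tN] := eqVneq `|t0| N.
    apply: bd; apply: le_trans bnd; rewrite ler_pM2l // tN.
    by have := normr_ge0 s0; lra.
  have sl : `|s0| < N by rewrite lt_neqAle sN.
  have tl : `|t0| < N by rewrite lt_neqAle tN.
  (* By [basis_bound] an [h] with [|h| < r] has coordinates too small to leave the parallelogram, so
     [z1] would be a local maximum. *)
  pose r := c * Num.min (N - `|s0|) (N - `|t0|).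
  have r0 : 0 < r by rewrite /r mulr_gt0 // lt_min !subr_gt0 sl.
  exfalso; apply: (no_interior_max (quotient_has_jet2 z1L) e0 r0) => h hr.
  have [a [b hE]] := basis_coord w2_neq0 w12 h.
  have hab : `|a| + `|b| < Num.min (N - `|s0|) (N - `|t0|).
    by rewrite -(ltr_pM2l c0); apply: le_lt_trans hr; rewrite hE; exact: Hc.
  have [ha hb] : `|a| < N - `|s0| /\ `|b| < N - `|t0|.
    move: hab; rewrite lt_min => /andP[].
    by have := normr_ge0 a; have := normr_ge0 b; split; lra.
  have -> : z1 + h = rc (s0 + a) * w1 + rc (t0 + b) * w2.
    by rewrite /z1 hE /rc !rmorphD /=; ring.
  by apply: H; apply: le_trans (ler_normD _ _) _; lra.
have q0 : quotient z = 0.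
  have main2 (N : R) : 0 < N -> `|s| <= N -> `|t| <= N -> cabs (quotient z) <= M ^+ 2 / (c * N).
    move=> N0 hs ht; have B0 : 0 <= M ^+ 2 / (c * N) by rewrite divr_ge0 ?exprn_ge0 ?mulr_ge0 // ltW.
    rewrite -(@ler_pXn2r _ 2) ?nnegrE ?cabs_ge0 //.
    apply/ler_addgt0Pr => e e0.
    (* For fixed [N], dividing [e] by this keeps the perturbation below [e]. *)
    have ND : 0 < (N * D) ^+ 2 + 1 by have := sqr_ge0 (N * D); lra.
    apply: le_trans (main N (e / ((N * D) ^+ 2 + 1)) N0 hs ht (divr_gt0 e0 ND)) _.
    rewrite lerD2l mulrAC ler_pdivrMr // ler_pM2l //; lra.
  apply/eqP; rewrite -cabs_eq0; apply/eqP; apply: le_anti.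
  rewrite cabs_ge0 andbT; apply/ler_addgt0Pl => e e0; rewrite addr0.
  (* Large enough for the parallelogram to contain [z] and for [M ^ 2 / (c N) <= e]. *)
  pose N := `|s| + `|t| + 1 + M ^+ 2 / c / e.
  have P : 0 <= M ^+ 2 / c / e by rewrite !divr_ge0 ?exprn_ge0 // ltW.
  have hs := normr_ge0 s; have ht := normr_ge0 t.
  have N0 : 0 < N by rewrite /N; lra.
  apply: le_trans (main2 N N0 _ _) _; try by rewrite /N; lra.
  rewrite invfM mulrA ler_pdivrMr // (mulrC e) -ler_pdivrMr // /N; lra.
(* At 0 [quotient] carries no information on [defect], which is 0 there by definition. *)
have [->|z0] := eqVneq z 0; first by apply: defect_in; exact: lattice0.
move/eqP: q0; rewrite /quotient mulf_eq0 invr_eq0 (negbTE z0) orbF.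
by rewrite sqrf_eq0 => /eqP.
Qed.

End Weierstrass.

Theorem proposition9 (R : realType) (w1 w2 : Cplx R)
    (w1_neq0 : w1 != 0) (w2_neq0 : w2 != 0)
    (w1w2_nreal : w1 / w2 \isn't Num.real) :
  [/\ meromorphic_with_poles_in (lattice w1 w2) (wp w1 w2),
      meromorphic_with_poles_in (lattice w1 w2) (dwp w1 w2)
    & forall z : Cplx R, ~ lattice w1 w2 z ->
        dwp w1 w2 z ^+ 2 =
          4 * wp w1 w2 z ^+ 3 - 60 * eisenstein w1 w2 4 * wp w1 w2 z
            - 140 * eisenstein w1 w2 6].
Proof.
split; [exact: wp_meromorphic|exact: dwp_meromorphic|move=> z zL].
have /eqP := defect_eq0 w2_neq0 w1w2_nreal z; rewrite defect_notin //.
rewrite addr_eq0 => /eqP h.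
by rewrite -[LHS](subrK (4 * wp w1 w2 z ^+ 3)) -[X in X + _](addrK (60 * eisenstein w1 w2 4 * wp w1 w2 z)) h; ring.
Qed.
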